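(* For every positive integer $t$ there is a constant $C_t$ such that for every integer $d\ge 1$: (i) there is a weighted spherical $t$-design on $S^{d-1}$ with at most $C_t\,d^{t-1}$ points; and (ii) there is a finite multiset of points of $S^{d-1}$ with at most $C_t\,d^{t-1}$ distinct points that forms an unweighted spherical $t$-design on $S^{d-1}$.
   Context: Let $\mu$ be the Lebesgue (surface) measure on the unit sphere $S^{d-1}\subset\mathbb{R}^d$, normalized so that $\mu(S^{d-1})=1$. A weighted spherical $t$-design is a finite set $X\subset S^{d-1}$ with a weight function $w\colon X\to\mathbb{R}_{>0}$ such that $\sum_{x\in X} w(x) f(x)=\int_{S^{d-1}} f\,d\mu$ for every polynomial $f$ of total degree at most $t$. A finite multiset $X$ of points of $S^{d-1}$ forms an unweighted spherical $t$-design if $\frac{1}{|X|}\sum_{x\in X} f(x)=\int_{S^{d-1}} f\,d\mu$ for every polynomial $f$ of total degree at most $t$, where the sum and $|X|$ count points with multiplicity. *)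

(* Defs.v *)
From HB Require Import structures.
From mathcomp Require Import all_boot all_order all_algebra.
From mathcomp Require Import finmap multiset.
From mathcomp Require mpoly.
From mathcomp Require Import all_classical all_reals all_analysis.
From mathcomp Require Import measurable_realfun.

Set Implicit Arguments.
Unset Strict Implicit.
Unset Printing Implicit Defensive.

Import Order.TTheory GRing.Theory Num.Theory.
Import numFieldNormedType.Exports.
Import (canonicals, coercions) mpoly.

Local Open Scope classical_set_scope.
Local Open Scope ring_scope.

Section cons_measure.
Context (R : realType) (n : nat).
Local Notation mR := (measurableTypeR R).

Definition cons_pair (p : (mR * n.-tuple mR)%type) : n.+1.-tuple mR :=
  [the n.+1.-tuple mR of p.1 :: p.2].

Definition uncons_pair (x : n.+1.-tuple mR) : (mR * n.-tuple mR)%type :=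
  (thead x, [tuple of behead x]).

Lemma cons_pairK : cancel cons_pair uncons_pair.
Proof. by case=> a x; congr pair; apply: val_inj. Qed.

Lemma measurable_cons_pair :
  measurable_fun [set: (mR * n.-tuple mR)%type] cons_pair.
Proof. exact: measurable_cons. Qed.

Lemma measurable_uncons_pair : measurable_fun [set: n.+1.-tuple mR] uncons_pair.
Proof.
apply: measurable_fun_pair; last exact: measurable_behead.
exact: (@measurable_tnth _ mR n.+1 ord0).
Qed.

Variable m : {sigma_finite_measure set (n.-tuple mR) -> \bar R}.

Let prodm : {measure set (mR * n.-tuple mR)%type -> \bar R} :=
  (@lebesgue_measure R \x m)%E.

Definition cons_measure : set (n.+1.-tuple mR) -> \bar R :=
  pushforward (@lebesgue_measure R \x m)%E cons_pair.

HB.instance Definition _ := Measure.copy cons_measure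
  (measure_function_pushforward__canonical__measure_function_Measure prodm
    measurable_cons_pair).

Let cons_measure_sigma_finite :
  sigma_finite [set: n.+1.-tuple mR] cons_measure.
Proof.
have /sigma_finiteP[F [FT ndF Foo]] := sigma_finiteT (@lebesgue_measure R).
have /sigma_finiteP[G [GT ndG Goo]] := sigma_finiteT m.
exists (fun k => uncons_pair @^-1` (F k `*` G k)).
  rewrite -preimage_bigcup (_ : \bigcup_k _ = setT) ?preimage_setT//.
  apply/seteqP; split => // -[a x] _.
  have [i _ Fa] : (\bigcup_i F i) a by rewrite -FT.
  have [j _ Gx] : (\bigcup_i G i) x by rewrite -GT.
  exists (maxn i j) => //; split => /=.
    by move: a Fa; exact/subsetPset/ndF/leq_maxl.
  by move: x Gx; exact/subsetPset/ndG/leq_maxr.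
move=> k; have [mF Fk] := Foo k; have [mG Gk] := Goo k; split.
  rewrite -[X in measurable X]setTI; apply: measurable_uncons_pair => //.
  exact: measurableX.
rewrite /cons_measure /pushforward (_ : _ @^-1` _ = F k `*` G k); last first.
  by apply/seteqP; split => p; rewrite /preimage /mkset cons_pairK.
by rewrite product_measure1E// lte_mul_pinfty// ge0_fin_numE.
Qed.

HB.instance Definition _ := @Measure_isSigmaFinite.Build _ _ _ cons_measure
  cons_measure_sigma_finite.

End cons_measure.

(* R^n is represented by n.-tuple (measurableTypeR R), whose sigma-algebra is
   the product one. *)
Fixpoint lebesgue_tuple (R : realType) (n : nat) :
    {sigma_finite_measure set (n.-tuple (measurableTypeR R)) -> \bar R} :=
  match n with
  | 0 => \d_([tuple] : 0.-tuple (measurableTypeR R))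
  | n'.+1 => cons_measure (lebesgue_tuple R n')
  end.

Section sphere.
Context (R : realType) (d : nat).
Local Notation mR := (measurableTypeR R).
Implicit Type x : d.-tuple mR.

Definition enorm x : R := Num.sqrt (\sum_(i < d) tnth x i ^+ 2).

Definition unit_sphere : set (d.-tuple mR) := [set x | enorm x = 1].

Definition unit_ball : set (d.-tuple mR) := [set x | enorm x <= 1].

Definition radial_proj x : d.-tuple mR :=
  [tuple (enorm x)^-1 * tnth x i | i < d].

Lemma measurable_enorm : measurable_fun [set: d.-tuple mR] enorm.
Proof.
apply: (@measurableT_comp _ _ _ _ _ _ (@Num.sqrt R)).
  by apply: continuous_measurable_fun => x; exact: sqrt_continuous.
apply: measurable_sum => i; apply: measurable_funX; exact: measurable_tnth.
Qed.

Lemma measurable_radial_proj : measurable_fun [set: d.-tuple mR] radial_proj.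
Proof.
apply/measurable_fun_tnthP => i.
rewrite (_ : _ \o _ = fun x => (enorm x `^ (-1)) * tnth x i); last first.
  by apply/funext => x /=; rewrite tnth_mktuple powR_inv1// sqrtr_ge0.
apply: measurable_funM; last exact: measurable_tnth.
by apply: (@measurableT_comp _ _ _ _ _ _ (@powR R ^~ (-1)));
  [exact: measurable_powR|exact: measurable_enorm].
Qed.

Lemma measurable_unit_ball : measurable unit_ball.
Proof.
rewrite (_ : unit_ball = enorm @^-1` `]-oo, 1]); last first.
  by apply/seteqP; split => x /=; rewrite in_itv.
by rewrite -[X in measurable X]setTI; exact: measurable_enorm.
Qed.

Lemma measurable_unit_sphere : measurable unit_sphere.
Proof.
rewrite (_ : unit_sphere = enorm @^-1` [set 1])//.
by rewrite -[X in measurable X]setTI; exact: measurable_enorm.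
Qed.

Let ballV_ge0 : 0 <= (fine (lebesgue_tuple R d unit_ball))^-1.
Proof. by rewrite invr_ge0 fine_ge0. Qed.

(* Integration in polar coordinates: the normalized surface measure of A is the
   proportion of the volume of the unit ball lying on the rays through A.  It
   is a measure on R^d carried by the sphere (sphere_measure_unit_sphere);
   radial_proj sends the origin to itself, off the sphere. *)
Definition sphere_measure (A : set (d.-tuple mR)) : \bar R :=
  ((fine (lebesgue_tuple R d unit_ball))^-1%:E *
   lebesgue_tuple R d (radial_proj @^-1` A `&` unit_ball))%E.

Let ball_measure : {measure set (d.-tuple mR) -> \bar R} :=
  mrestr (lebesgue_tuple R d) measurable_unit_ball.

Let push_ball_measure : {measure set (d.-tuple mR) -> \bar R} :=
  measure_function_pushforward__canonical__measure_function_Measure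
    ball_measure measurable_radial_proj.

HB.instance Definition _ := Measure.copy sphere_measure
  (mscale (NngNum ballV_ge0) push_ball_measure).

End sphere.

Arguments unit_sphere {R d}.
Arguments unit_ball {R d}.
Arguments sphere_measure {R d}.

Section sphere_measure_total.
Context (R : realType).
Local Notation mR := (measurableTypeR R).

Lemma measurable_box n (a b : R) :
  measurable ([set x | forall i, a <= tnth x i <= b] : set (n.-tuple mR)).
Proof.
rewrite (_ : [set _ | _] =
    \bigcap_(i : 'I_n) ((@tnth _ mR ^~ i) @^-1` `[a, b])).
  apply: fin_bigcap_measurable; first exact: finite_finset.
  move=> i _; rewrite -[X in measurable X]setTI.
  by apply: measurable_tnth.
apply/seteqP; split => x /= h i.
  by rewrite /= in_itv/= => _; exact: h.
by have := h i I; rewrite /= in_itv.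
Qed.

Lemma lebesgue_tuple_box n (a b : R) : a <= b ->
  lebesgue_tuple R n [set x | forall i, a <= tnth x i <= b] = ((b - a) ^+ n)%:E.
Proof.
move=> ab; elim: n => [|n IHn].
  rewrite /= diracE expr0 (_ : _ \in _)//.
  by rewrite inE => -[].
rewrite /= /cons_measure /pushforward.
rewrite (_ : _ @^-1` _ =
  `[a, b] `*` [set x | forall i, a <= tnth x i <= b]); last first.
  apply/seteqP; split => -[u x] /=.
    move=> h; split; first by have := h ord0; rewrite in_itv.
    by move=> i; have := h (lift ord0 i); rewrite tnthS.
  rewrite in_itv/= => -[hu hx] i.
  by case: (unliftP ord0 i) => [j ->|->]; rewrite ?tnthS.
rewrite product_measure1E//=.
- rewrite IHn lebesgue_measure_itv/= lte_fin exprS EFinM.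
  case: ltP => [_|ba]; first by rewrite EFinB.
  by rewrite (_ : b = a) ?subrr//; apply/eqP; rewrite eq_le ab ba.
- exact: measurable_box.
Qed.

Lemma lebesgue_unit_ball_gt0 d : (0 < lebesgue_tuple R d unit_ball)%E.
Proof.
pose b : R := d.+1%:R^-1.
have b0 : 0 < b by rewrite invr_gt0.
have b1 : b <= 1 by rewrite invf_le1// ler1n.
apply: (@lt_le_trans _ _
  (lebesgue_tuple R d [set x | forall i, 0 <= tnth x i <= b])).
  by rewrite lebesgue_tuple_box ?ltW// lte_fin exprn_gt0// subr0.
apply: le_measure; rewrite ?inE;
  [exact: measurable_box|exact: measurable_unit_ball|].
move=> x /= h; rewrite /unit_ball /= /enorm -sqrtr1 ler_wsqrtr//.
apply: (@le_trans _ _ (\sum_(i < d) b)).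
  apply: ler_sum => i _; have /andP[h0 h1] := h i.
  by rewrite expr2 (le_trans (ler_pM h0 h0 h1 h1))// ler_piMr// ltW.
by rewrite sumr_const card_ord -mulr_natl /b ler_pdivrMr// mul1r ler_nat.
Qed.

Lemma lebesgue_unit_ball_lty d : (lebesgue_tuple R d unit_ball < +oo)%E.
Proof.
apply: (@le_lt_trans _ _
  (lebesgue_tuple R d [set x | forall i, -1 <= tnth x i <= 1])).
  apply: le_measure; rewrite ?inE;
    [exact: measurable_unit_ball|exact: measurable_box|].
  move=> x /= h i; rewrite -ler_norml -sqrtr_sqr (le_trans _ h)// ler_wsqrtr//.
  by rewrite (bigD1 i)//= lerDl sumr_ge0// => j _; rewrite sqr_ge0.
by rewrite lebesgue_tuple_box// ?ltry// -subr_ge0 opprK.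
Qed.

Lemma sphere_measure_setT d : sphere_measure [set: d.-tuple mR] = 1%E :> \bar R.
Proof.
have := lebesgue_unit_ball_gt0 d; have := lebesgue_unit_ball_lty d.
rewrite /sphere_measure preimage_setT setTI.
case: (lebesgue_tuple R d _) => // r _; rewrite lte_fin => r0 /=.
by rewrite -EFinM mulVf ?gt_eqF.
Qed.

Lemma sphere_measure_unit_sphere d : (0 < d)%N ->
  sphere_measure (@unit_sphere R d) = 1%E.
Proof.
move=> d0; have mS := @measurable_unit_sphere R d.
have := sphere_measure_setT d; rewrite -(setUv (@unit_sphere R d)).
rewrite measureU//; [|exact: measurableC|by rewrite setICr].
suff /= -> : @sphere_measure R d (~` unit_sphere) = 0%E by rewrite adde0.
rewrite /sphere_measure [X in (_ * X)%E](_ : _ = 0%E) ?mule0//.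
apply/eqP; rewrite eq_le measure_ge0 andbT.
have <- : lebesgue_tuple R d [set x | forall i, 0 <= tnth x i <= 0] = 0%E.
  by rewrite lebesgue_tuple_box// subrr expr0n eqn0Ngt d0.
apply: le_measure; rewrite ?inE.
- apply: measurableI; last exact: (@measurable_unit_ball R d).
  rewrite -[X in measurable X]setTI; apply: (@measurable_radial_proj R d) => //.
  exact: measurableC.
- exact: measurable_box.
- move=> x [/= h _] i; rewrite -eq_le eq_sym; apply: contra_notT h => xi0.
  have s0 : 0 < \sum_(i < d) tnth x i ^+ 2.
    rewrite (bigD1 i)//= ltr_wpDr ?exprn_even_gt0//.
    by rewrite sumr_ge0// => j _; rewrite sqr_ge0.
  have e0 : 0 < enorm x by rewrite sqrtr_gt0.
  rewrite /unit_sphere /= {1}/enorm.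
  under eq_bigr => j _ do rewrite tnth_mktuple exprMn.
  rewrite -mulr_sumr -(@sqr_sqrtr _ (\sum_(i < d) _)) ?ltW// -/(enorm x).
  by rewrite -exprMn mulVf ?gt_eqF// expr1n sqrtr1.
Qed.

End sphere_measure_total.

Section designs.
Context (R : realType) (d : nat).
Local Open Scope mset_scope.

(* msize is the total degree plus one, and 0 for the zero polynomial. *)
Definition weighted_spherical_design (t : nat) (X : {fset d.-tuple R})
    (w : d.-tuple R -> R) : Prop :=
  [/\ forall x, x \in X -> unit_sphere x,
      forall x, x \in X -> 0 < w x &
      forall p : mpoly.mpoly d R, (mpoly.msize p <= t.+1)%N ->
        (\sum_(x <- X) w x * mpoly.meval (tnth x) p)%:E =
        (\int[@sphere_measure R d]_(x in unit_sphere)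
           (mpoly.meval (tnth x) p)%:E)%E].

(* As a sequence, a multiset lists its points with their multiplicities.  The
   empty multiset is not a design: test with p = 1. *)
Definition unweighted_spherical_design (t : nat) (X : {mset d.-tuple R}) :
    Prop :=
  (forall x, x \in X -> unit_sphere x) /\
  forall p : mpoly.mpoly d R, (mpoly.msize p <= t.+1)%N ->
    ((size X)%:R^-1 * \sum_(x <- X) mpoly.meval (tnth x) p)%:E =
    (\int[@sphere_measure R d]_(x in unit_sphere)
       (mpoly.meval (tnth x) p)%:E)%E.

End designs.

(* Main.v *)
Require Import Defs.
From HB Require Import structures.
From mathcomp Require Import all_boot all_order all_algebra.
From mathcomp Require Import finmap multiset.
From mathcomp Require mpoly complex.
From mathcomp Require Import ring.
From mathcomp Require Import all_classical all_reals all_analysis.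
From mathcomp Require Import measurable_realfun.

Set Implicit Arguments.
Unset Strict Implicit.
Unset Printing Implicit Defensive.

Import Order.TTheory GRing.Theory Num.Theory.
Import numFieldNormedType.Exports.
Import (canonicals, coercions) mpoly complex.

Local Open Scope classical_set_scope.
Local Open Scope ring_scope.

(** Why the bound is d^(t-1).  If the coordinates of a random point X of R^d are
    t-wise independent and each of them has the moments of a centred Gaussian up
    to order t, then a homogeneous polynomial f of degree t has the same mean at X
    as at a Gaussian vector, and in polar coordinates the latter mean is a fixed
    multiple of the mean of f over the sphere.  As f(X) = |X|^t f(X / |X|), the
    points X / |X| weighted by |X|^t therefore integrate f exactly over the sphere.
    Let t = 2k be even, and add the antipodes: odd polynomials integrate to 0, and
    an even polynomial of lower degree becomes homogeneous of degree 2k after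
    multiplication by a power of |x|^2, which is 1 on the sphere.  The result has
    strength 2k + 1, so that it serves the degrees 2k and 2k + 1.  When X has
    integer coordinates, |X|^(2k) is an integer, and repeating each point
    accordingly yields the unweighted design
    ([design_of_integer_points]); the weighted one is the same set of points with
    the relative multiplicities as weights ([weighted_of_unweighted]).

    Few points suffice for t-wise independence.  Choose greedily d vectors v_i in
    F_P^r such that any t of them are linearly independent: a new vector only has
    to avoid the combinations of t - 1 old ones, at most (d P)^(t-1) of them, so
    that P^r can be taken at most P (d P)^(t-1) ([gilbert_varshamov]).  For u uniform
    in F_P^r the scalars u . v_i are uniform and t-wise independent
    ([independent_moments]).

    It remains to find a map g from F_P to the integers under which the uniform
    distribution acquires Gaussian moments up to order t, up to scaling
    ([gauss_multiset]).  Gauss-Hermite quadrature has real nodes and positive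
    weights.  Positivity survives a small displacement of the nodes, hence nodes
    Y_i / N with Y_i an integer, and also the subtraction of a small multiple of
    the uniform measure on 0, ..., t.  For a large prime P the weights at the Y_i
    are then rounded to multiples of 1 / P; Lagrange interpolation at 0, ..., t
    transfers the error to these nodes, where the subtracted mass keeps the weights
    nonnegative.  They are multiples of 1 / P as well because N is divisible by the
    denominators of the Lagrange polynomials.

    On the analytic side, the mean over the sphere is the mean of f(x / |x|) over
    the unit ball, and it is compared with the Gaussian integral of f by a double
    integral over points and dilations ([ge0_integral_radial]), which needs only
    the theorem of Tonelli and the behaviour of the Lebesgue measure under
    scaling.  The Gaussian integral of a monomial is a product of integrals over
    the line ([gauss_even_moment]); monomials with an odd exponent vanish by
    reflection ([sphere_odd_moments]). *)

(** * Gaussian moments and Hermite polynomials *)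

Fixpoint gauss_moment (n : nat) : nat :=
  match n with
  | 0 => 1
  | 1 => 0
  | k.+2 => k.+1 * gauss_moment k
  end.

Section gauss_functional.
Context (R : comNzRingType).
Implicit Types p q : {poly R}.

(** The mean of p at a standard Gaussian variable, defined on coefficients so that
    its rational and integral structure is available. *)
Definition gaussE p : R := \sum_(i < size p) p`_i * (gauss_moment i)%:R.

Lemma gaussE_wide n p : (size p <= n)%N ->
  gaussE p = \sum_(i < n) p`_i * (gauss_moment i)%:R.
Proof.
move=> pn; rewrite /gaussE (big_ord_widen n (fun i => p`_i * (gauss_moment i)%:R))//.
rewrite big_mkcond/=; apply: eq_bigr => i _; case: ltnP => // ip.
by rewrite nth_default// mul0r.
Qed.

Lemma gaussE_is_linear : linear_for *%R gaussE.
Proof.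
move=> a p q; pose n := maxn (size p) (size q).
rewrite (@gaussE_wide n p) ?leq_maxl// (@gaussE_wide n q) ?leq_maxr//.
rewrite (@gaussE_wide n); last first.
  rewrite (leq_trans (size_polyD _ _))// geq_max leq_maxr andbT.
  by rewrite (leq_trans (size_scale_leq _ _))// leq_maxl.
rewrite mulr_sumr -big_split/=; apply: eq_bigr => i _.
by rewrite coefD coefZ mulrDl mulrA.
Qed.

HB.instance Definition _ :=
  GRing.isLinear.Build R {poly R} R *%R gaussE gaussE_is_linear.

Lemma gaussEXn n : gaussE 'X^n = (gauss_moment n)%:R.
Proof.
rewrite /gaussE size_polyXn big_ord_recr/= coefXn eqxx mul1r big1 ?add0r// => i _.
by rewrite coefXn ltn_eqF ?mul0r.
Qed.

Lemma gaussEC c : gaussE c%:P = c.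
Proof. by rewrite -alg_polyC linearZ/= -(expr0 'X) gaussEXn mulr1. Qed.

(** Integration by parts against the Gaussian density. *)
Lemma gaussEXM p : gaussE ('X * p) = gaussE p^`().
Proof.
have -> : 'X * p = \sum_(i < size p) p`_i *: 'X^(i.+1).
  rewrite -{1}[p]coefK poly_def mulr_sumr; apply: eq_bigr => i _.
  by rewrite -scalerAr -exprS.
have -> : p^`() = \sum_(i < size p) p`_i *: ('X^i)^`().
  rewrite -{1}[p]coefK poly_def linear_sum; apply: eq_bigr => i _.
  by rewrite linearZ.
rewrite !linear_sum; apply: eq_bigr => i _.
rewrite !linearZ/= gaussEXn derivXn linearMn/=.
case: (i : nat) => [|k]; first by rewrite mulr0n.
by rewrite gaussEXn mulnC natrM mulr_natr.
Qed.
End gauss_functional.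

Fixpoint hermite (R : nzRingType) (n : nat) : {poly R} :=
  if n is k.+1 then 'X * hermite R k - (hermite R k)^`() else 1.

Section hermite_theory.
Context (R : realFieldType).
Local Notation H := (hermite R).
Implicit Types p q : {poly R}.

Lemma hermite_monic_size n : (H n \is monic) /\ size (H n) = n.+1.
Proof.
elim: n => [|n [mH sH]]; first by rewrite /= monic1 size_poly1.
have H0 : H n != 0 by exact: monic_neq0.
have sXH : size ('X * H n) = n.+2 by rewrite mulrC size_mulX// sH.
have sd : (size (- (H n)^`())%R < size ('X * H n)%R)%N.
  by rewrite size_polyN sXH ltnS ltnW// (leq_trans (lt_size_deriv H0))// sH.
split; last by rewrite /= size_polyDl.
by rewrite /= monicE lead_coefDl// -monicE monicMl ?monicX.
Qed.

(** Each factor X - d/dx of the Hermite polynomial is moved onto q as a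
    derivative, by [gaussEXM]. *)
Lemma gaussE_hermite n q : gaussE (H n * q) = gaussE q^`(n).
Proof.
elim: n q => [|n IHn] q; first by rewrite mul1r derivn0.
rewrite /= mulrBl -mulrA linearB/= gaussEXM derivM linearD/= addrAC subrr add0r.
by rewrite IHn -derivSn.
Qed.

Lemma gaussE_hermite_orth n q : (size q <= n)%N -> gaussE (H n * q) = 0.
Proof. by move=> qn; rewrite gaussE_hermite derivn_poly0// linear0. Qed.

(** Split off the leading term along the Hermite polynomial of the same degree:
    it is orthogonal to the remainder, and its square has mean c^2 n!. *)
Lemma gaussE_sqr_gt0 q : q != 0 -> 0 < gaussE (q ^+ 2).
Proof.
have [n] := ubnP (size q); elim: n q => // n IHn q.
rewrite ltnS leq_eqVlt => /predU1P[sq|]; last exact: IHn.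
case: n => [|n] in IHn sq *; first by rewrite -size_poly_eq0 sq.
move=> q0; pose c := lead_coef q; pose r := q - c *: H n.
have c0 : c != 0 by rewrite lead_coef_eq0.
have [mH sH] := hermite_monic_size n.
have Hn : (H n)`_n = 1 by have := monicP mH; rewrite lead_coefE sH.
have sr : (size r <= n)%N.
  apply/leq_sizeP => j; rewrite leq_eqVlt coefB coefZ => /predU1P[<-|nj].
    by rewrite Hn mulr1 /c lead_coefE sq subrr.
  by rewrite !nth_default ?sH ?sq ?mulr0 ?subrr.
have -> : q = c *: H n + r by rewrite addrC subrK.
have -> : (c *: H n + r) ^+ 2 = c ^+ 2 *: (H n * H n) + c *+ 2 *: (H n * r) + r ^+ 2.
  by rewrite -!mul_polyC polyCM polyCMn; ring.
rewrite !linearD !linearZ/= (gaussE_hermite_orth sr) mulr0 addr0.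
have -> : gaussE (H n * H n) = n`!%:R.
  rewrite gaussE_hermite (@size1_polyC _ ((H n)^`(n))); last first.
    apply/leq_sizeP => j j0; rewrite coef_derivn nth_default ?mul0rn// sH.
    by rewrite -[X in (X < _)%N]addn0 ltn_add2l.
  rewrite gaussEC coef_derivn addn0 ffactnn.
  by rewrite Hn.
have : 0 < c ^+ 2 * n`!%:R.
  by rewrite mulr_gt0 ?ltr0n ?fact_gt0// exprn_even_gt0.
have [->|r0] := eqVneq r 0; first by rewrite expr0n linear0 addr0.
by move=> ?; rewrite addr_gt0// IHn// ltnS.
Qed.

(** Such a factorisation would give the pairing of H_n with q, which is zero for
    degree reasons, the positive value E[((X - a) q)^2] + b^2 E[q^2].  The case
    b != 0 excludes nonreal roots and the case b = 0 excludes double roots. *)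
Lemma hermite_no_square_factor n (a b : R) q :
  H n != (('X - a%:P) ^+ 2 + (b ^+ 2)%:P) * q.
Proof.
apply/eqP => HE; have [mH sH] := hermite_monic_size n.
have q0 : q != 0.
  by apply: contraTneq mH => q0; rewrite HE q0 mulr0 monicE lead_coef0 eq_sym oner_eq0.
have Q0 : ('X - a%:P) ^+ 2 + (b ^+ 2)%:P != 0.
  by apply: contraTneq mH => Q0; rewrite HE Q0 mul0r monicE lead_coef0 eq_sym oner_eq0.
have sQ : size (('X - a%:P) ^+ 2 + (b ^+ 2)%:P) = 3%N.
  rewrite size_polyDl size_exp_XsubC// (leq_ltn_trans (size_polyC_leq1 _))//.
have sq : (size q <= n)%N.
  have := sH; rewrite HE size_mul// sQ /= => -[<-].
  by rewrite leqnSn.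
have := gaussE_hermite_orth sq; rewrite HE.
have -> : (('X - a%:P) ^+ 2 + (b ^+ 2)%:P) * q * q =
    (('X - a%:P) * q) ^+ 2 + b ^+ 2 *: q ^+ 2.
  by rewrite -mul_polyC; ring.
rewrite linearD linearZ/= => /eqP; rewrite gt_eqF// ltr_wpDr//.
  by rewrite mulr_ge0 ?sqr_ge0// ltW// gaussE_sqr_gt0.
by rewrite gaussE_sqr_gt0// mulf_neq0// polyXsubC_eq0.
Qed.
End hermite_theory.

Lemma prod_XsubC_not_uniq (R : comNzRingType) (s : seq R) : ~~ uniq s ->
  exists a q, \prod_(x <- s) ('X - x%:P) = ('X - a%:P) ^+ 2 * q.
Proof.
elim: s => //= a s IHs; rewrite negb_and negbK => /orP[as_|/IHs[b [q sE]]].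
  exists a, (\prod_(x <- rem a s) ('X - x%:P)).
  by rewrite big_cons (perm_big _ (perm_to_rem as_)) big_cons mulrA.
by exists b, (('X - a%:P) * q); rewrite big_cons sE mulrCA.
Qed.

Lemma hermite_splits (R : rcfType) n : exists s : seq R,
  uniq s /\ hermite R n = \prod_(a <- s) ('X - a%:P).
Proof.
pose f := complex.real_complex R; pose P := hermite R n.
have [rs] := closed_field_poly_normal (map_poly f P).
have [mH _] := hermite_monic_size R n.
rewrite lead_coef_map (monicP mH) rmorph1 scale1r => PE.
have root_real z : z \in rs -> z = f (complex.Re z).
  move=> zrs; have : root (map_poly f P) z by rewrite PE root_prod_XsubC.
  case: z zrs => a b _ rz; have [->//|b0] := eqVneq b 0.
  pose Q : {poly R} := ('X - a%:P) ^+ 2 + (b ^+ 2)%:P.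
  have sQ : size Q = 3%N.
    by rewrite size_polyDl size_exp_XsubC// (leq_ltn_trans (size_polyC_leq1 _)).
  have Qz : (map_poly f Q).[complex.Complex a b] = 0.
    rewrite rmorphD/= rmorphXn/= rmorphB/= map_polyX !map_polyC/= !hornerE.
    rewrite /f /complex.real_complex_def/= !expr2; apply/eqP.
    by rewrite complex.eq_complex/=; apply/andP; split; apply/eqP; ring.
  have Q0 : Q != 0 by rewrite -size_poly_eq0 sQ.
  (* The remainder has degree at most 1 and a nonreal root, hence it vanishes. *)
  pose r := P %% Q.
  have sr : (size r <= 2)%N by rewrite -ltnS -sQ ltn_modp.
  have : (map_poly f r).[complex.Complex a b] = 0.
    move: rz; rewrite {1}(divp_eq P Q) rmorphD rmorphM/= /root hornerD hornerM Qz mulr0 add0r.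
    by move/eqP.
  have rE : r = r`_1 *: 'X + (r`_0)%:P.
    apply/polyP => -[|[|j]]; rewrite coefD coefZ coefX coefC/= ?mulr0 ?mulr1 ?add0r ?addr0//.
    by rewrite nth_default// (leq_trans sr).
  rewrite rE rmorphD/= map_polyZ/= map_polyX map_polyC/= !hornerE.
  move/eqP; rewrite complex.eq_complex/= => /andP[].
  rewrite !mul0r !subr0 !addr0 => /eqP r01; rewrite mulf_eq0 (negPf b0) orbF => /eqP r1.
  move: r01; rewrite r1 mul0r add0r => r0.
  have rz0 : r = 0 by rewrite rE r1 r0 scale0r add0r.
  have := hermite_no_square_factor n a b (P %/ Q).
  by rewrite -/Q mulrC -[X in X != _]/P {1}(divp_eq P Q) -/r rz0 addr0 eqxx.
pose s := map (@complex.Re R) rs.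
have Ps : P = \prod_(a <- s) ('X - a%:P).
  apply: (map_poly_inj f); rewrite PE rmorph_prod/= big_map [LHS]big_seq [RHS]big_seq.
  apply: eq_bigr => z zrs.
  by rewrite rmorphB/= map_polyX map_polyC/= {1}(root_real _ zrs).
exists s; split=> //; apply: contraT => /prod_XsubC_not_uniq[a [q]].
by move=> sE; have := hermite_no_square_factor n a 0 q; rewrite -/P Ps sE expr0n addr0 eqxx.
Qed.

(** * Lagrange interpolation and Gauss-Hermite quadrature *)

Section interpolation.
Context (F : fieldType) (n : nat).
Implicit Types (x : 'I_n -> F) (p : {poly F}).

Definition nodal x (i : 'I_n) : {poly F} := \prod_(j | j != i) ('X - (x j)%:P).

Definition lagrange_basis x i := ((nodal x i).[x i])^-1 *: nodal x i.

Lemma hornerX_nodal x i k : (nodal x i).[x k] = \prod_(j | j != i) (x k - x j).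
Proof. by rewrite horner_prod; apply: eq_bigr => j _; rewrite !hornerE. Qed.

Lemma nodal_eq0 x i k : k != i -> (nodal x i).[x k] = 0.
Proof. by move=> ki; rewrite hornerX_nodal (bigD1 k)//= subrr mul0r. Qed.

Lemma nodal_neq0 x i : injective x -> (nodal x i).[x i] != 0.
Proof.
move=> injx; rewrite hornerX_nodal prodf_seq_neq0; apply/allP => j _.
by apply/implyP => ji; rewrite subr_eq0; apply: contra_neq ji => /injx.
Qed.

Lemma nodal_inj x : (forall i, (nodal x i).[x i] != 0) -> injective x.
Proof.
move=> x0 i j xij; have [//|ij] := eqVneq i j.
by have := x0 i; rewrite xij nodal_eq0 ?eqxx// eq_sym.
Qed.

Lemma size_nodal x i : (size (nodal x i) <= n)%N.
Proof.
rewrite /nodal (eq_bigl (mem (predC1 i)))// -big_enum size_prod_XsubC -cardE.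
by rewrite cardC1 card_ord (ltn_predK (ltn_ord i)).
Qed.

Lemma interpolation x p : injective x -> (size p <= n)%N ->
  p = \sum_i p.[x i] *: lagrange_basis x i.
Proof.
move=> injx sp; apply/eqP; rewrite -subr_eq0; apply/eqP.
apply: (@roots_geq_poly_eq0 _ _ [seq x i | i <- enum 'I_n]).
- apply/allP => _ /mapP[k _ ->]; rewrite /root hornerD hornerN horner_sum.
  rewrite (bigD1 k)//= big1 ?addr0.
    by rewrite /lagrange_basis !hornerZ mulVf ?mulr1 ?subrr ?nodal_neq0.
  move=> i ik; have ki : k != i by rewrite eq_sym.
  by rewrite /lagrange_basis !hornerZ (nodal_eq0 x ki) !mulr0.
- by rewrite map_inj_uniq ?enum_uniq.
- rewrite size_map size_enum_ord (leq_trans (size_polyD _ _))// size_polyN geq_max sp/=.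
  apply: (leq_trans (size_sum _ _ _)); apply/bigmax_leqP => i _.
  by rewrite (leq_trans (size_scale_leq _ _))// (leq_trans (size_scale_leq _ _))// size_nodal.
Qed.
End interpolation.

Lemma lagrange_basisE (F : fieldType) n (x : 'I_n -> F) i k : injective x ->
  (lagrange_basis x i).[x k] = (i == k)%:R.
Proof.
move=> injx; rewrite /lagrange_basis hornerZ; have [->|ik] := eqVneq i k.
  by rewrite mulVf// nodal_neq0.
by rewrite (@nodal_eq0 _ _ x i k) ?mulr0// eq_sym.
Qed.

(** The weights of the Gauss-Hermite rule are positive: if l_i is the Lagrange
    basis at the roots of H_n, then l_i^2 - l_i is a multiple of H_n with quotient of
    degree less than n, so that E[l_i] = E[l_i^2] > 0.  The sign condition is
    written without division because it is then a continuous function of the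
    nodes. *)
Lemma gauss_hermite_weights (R : rcfType) n : exists x : 'I_n -> R,
  forall i, 0 < gaussE (nodal x i) * (nodal x i).[x i].
Proof.
have [s [us HE]] := hermite_splits R n.
have [_ sH] := hermite_monic_size R n.
have ss : size s = n by have := size_prod_XsubC s id; rewrite -HE sH => -[].
pose x (i : 'I_n) := s`_i.
have Hx : hermite R n = \prod_i ('X - (x i)%:P).
  by rewrite HE (big_nth 0) big_mkord ss.
have injx : injective x.
  by move=> i j /eqP; rewrite nth_uniq ?ss// => /eqP/val_inj.
exists x => i; set W := nodal x i.
have W0 : W.[x i] != 0 by exact: nodal_neq0.
have W0' : W != 0 by apply: contraNneq W0 => ->; rewrite horner0.
have /factor_theorem[q qE] : root (W - (W.[x i])%:P) (x i).
  by rewrite /root !hornerE subrr.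
have sq : (size q <= n)%N.
  have [->|q0] := eqVneq q 0; first by rewrite size_poly0.
  have : (size (W - (W.[x i])%:P)%R <= n)%N.
    rewrite (leq_trans (size_polyD _ _))// size_polyN geq_max size_nodal/=.
    by rewrite (leq_trans (size_polyC_leq1 _))// (leq_ltn_trans _ (ltn_ord i)).
  by rewrite qE size_Mmonic ?monicXsubC// size_XsubC addn2/=; exact: ltnW.
have WE : W ^+ 2 = W.[x i] *: W + hermite R n * q.
  rewrite Hx (bigD1 i)//= -/(nodal x i) -/W -mul_polyC.
  rewrite expr2 {1}(_ : W = q * ('X - (x i)%:P) + (W.[x i])%:P); last by rewrite -qE subrK.
  by ring.
have := gaussE_sqr_gt0 W0'; rewrite WE linearD/= gaussE_hermite_orth// addr0 linearZ/=.
by rewrite mulrC.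
Qed.

(** * A quadrature rule with integer nodes and equal weights *)

(** The factor q makes the induction on the product go through, since it absorbs
    the powers of X that are split off. *)
Lemma cvg_gaussE_prod_XsubC (R : realType) (I : Type) (r : seq I) (P : pred I)
    (y : nat -> I -> R) (x : I -> R) (q : {poly R}) :
  (forall j, y k j @[k --> \oo] --> x j) ->
  gaussE (\prod_(j <- r | P j) ('X - (y k j)%:P) * q) @[k --> \oo] -->
  gaussE (\prod_(j <- r | P j) ('X - (x j)%:P) * q).
Proof.
move=> yx; elim: r q => [|j r IHr] q.
  rewrite big_nil (_ : (fun _ => _) = fun=> gaussE (1 * q)); first exact: cvg_cst.
  by apply/funext => k; rewrite big_nil.
have step (z : I -> R) : gaussE (\prod_(i <- j :: r | P i) ('X - (z i)%:P) * q) =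
    if P j then gaussE (\prod_(i <- r | P i) ('X - (z i)%:P) * ('X * q)) -
           z j * gaussE (\prod_(i <- r | P i) ('X - (z i)%:P) * q)
    else gaussE (\prod_(i <- r | P i) ('X - (z i)%:P) * q).
  rewrite big_cons; case: (P j) => //; rewrite -linearZ -linearB/=; congr gaussE.
  by rewrite -mul_polyC; ring.
under eq_cvg do rewrite step; rewrite step; case: (P j); last exact: IHr.
by apply: cvgB; [exact: IHr|apply: cvgM; [exact: yx|exact: IHr]].
Qed.

Lemma cvg_nodal (R : realType) n (y : nat -> 'I_n -> R) (x : 'I_n -> R) i :
  (forall j, y k j @[k --> \oo] --> x j) ->
  gaussE (nodal (y k) i) * (nodal (y k) i).[y k i] @[k --> \oo] -->
  gaussE (nodal x i) * (nodal x i).[x i].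
Proof.
move=> yx; apply: cvgM.
  have := cvg_gaussE_prod_XsubC (r := index_enum _) (P := predC1 i) (q := 1) yx.
  by under eq_cvg do rewrite mulr1; rewrite mulr1.
rewrite hornerX_nodal; under eq_cvg do rewrite hornerX_nodal.
apply: cvg_big => [|j _]; first exact: mul_continuous.
by apply: cvgB; exact: yx.
Qed.

Lemma cvg_floor_ratio (R : realType) (D : nat) (x : R) : (0 < D)%N ->
  (Num.floor (x * (D * k.+1)%:R))%:~R / (D * k.+1)%:R @[k --> \oo] --> x.
Proof.
move=> D0; apply: (@squeeze_cvgr _ _ _ _ (fun k => x - k.+1%:R^-1) (cst x)); last 2 first.
- rewrite -[X in _ --> X]subr0; apply: cvgB; first exact: cvg_cst.
  exact: cvg_harmonic.
- exact: cvg_cst.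
near=> k; have N0 : 0 < (D * k.+1)%:R :> R by rewrite ltr0n muln_gt0 D0.
rewrite ler_pdivlMr// ler_pdivrMr// floor_le andbT.
have := floorD1_gt (x * (D * k.+1)%:R); rewrite intrD -ltrBlDr => /ltW; apply: le_trans.
rewrite mulrBl lerB// natrM mulrCA mulVf ?mulr1 ?ler1n//.
Unshelve. all: by end_near. Qed.

(** Displace the Gauss-Hermite nodes x_i to floor (N x_i) / N, with N a large
    multiple of D. *)
Lemma gauss_integer_nodes (R : realType) n (D : nat) : (0 < D)%N ->
  exists (N : nat) (Y : 'I_n -> int), [/\ (0 < N)%N, (D %| N)%N,
    injective (fun i => (Y i)%:~R : R) &
    forall i, 0 < gaussE (lagrange_basis (fun j => (Y j)%:~R : R) i \Po (N%:R *: 'X))].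
Proof.
move=> D0; have [x x0] := gauss_hermite_weights R n.
pose Y k j : int := Num.floor (x j * (D * k.+1)%:R).
pose y k j : R := (Y k j)%:~R / (D * k.+1)%:R.
have yx j : y k j @[k --> \oo] --> x j by exact: cvg_floor_ratio.
have [k yk] : exists k, forall i, 0 < gaussE (nodal (y k) i) * (nodal (y k) i).[y k i].
  near \oo => k; exists k.
  near: k; apply: filter_forall => i.
  exact: cvgr_gt (cvg_nodal (i := i) yx) _ (x0 i).
pose N := (D * k.+1)%N; have N0 : (0 < N)%N by rewrite muln_gt0 D0.
have NR : N%:R != 0 :> R by rewrite pnatr_eq0 -lt0n.
have YN i : (Y k i)%:~R = y k i * N%:R :> R by rewrite /y divfK.
have injy : injective (y k).
  by apply: nodal_inj => i; apply: contraTneq (yk i) => ->; rewrite mulr0 ltxx.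
exists N, (Y k); split=> //; first exact: dvdn_mulr.
  by move=> i j; rewrite !YN => /(mulIf NR)/injy.
move=> i.
have -> : lagrange_basis (fun j => (Y k j)%:~R : R) i \Po (N%:R *: 'X) =
    lagrange_basis (y k) i.
  rewrite /lagrange_basis comp_polyZ hornerX_nodal hornerX_nodal.
  have -> : nodal (fun j => (Y k j)%:~R : R) i \Po (N%:R *: 'X) =
      \prod_(j | j != i) N%:R *: nodal (y k) i.
    rewrite /nodal rmorph_prod/= -scaler_prod; apply: eq_bigr => j _.
    by rewrite comp_polyB comp_polyX comp_polyC YN scalerBr polyCM mulrC mul_polyC.
  rewrite scalerA; congr (_ *: _).
  under eq_bigr do rewrite !YN -mulrBl; rewrite big_split/= invfM -mulrA mulVf ?mulr1//.
  by apply/prodf_neq0.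
rewrite linearZ/=; set c := (nodal (y k) i).[y k i].
have c0 : c != 0 by exact: nodal_neq0.
rewrite -(@pmulr_rgt0 _ (c ^+ 2)) ?exprn_even_gt0// mulrA expr2 mulfK// mulrC.
exact: yk.
Unshelve. all: by end_near. Qed.

Section scaled_functional.
Context (R : archiRealFieldType) (N : nat).

Definition scaled_gaussE (p : {poly R}) := gaussE (p \Po (N%:R *: 'X)).

Lemma scaled_gaussE_is_linear : linear_for *%R scaled_gaussE.
Proof. by move=> a p q; rewrite /scaled_gaussE linearP linearP. Qed.

HB.instance Definition _ :=
  GRing.isLinear.Build R {poly R} R *%R scaled_gaussE scaled_gaussE_is_linear.

Lemma scaled_gaussEXn k : scaled_gaussE 'X^k = N%:R ^+ k * (gauss_moment k)%:R.
Proof. by rewrite /scaled_gaussE comp_Xn_poly exprZn linearZ/= gaussEXn. Qed.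

(** Modulo N only the constant coefficient contributes: this is the source of the
    integrality of the corrected weights in [gauss_multiset]. *)
Lemma scaled_gaussE_int (p : {poly int}) :
  exists z : int, scaled_gaussE (map_poly intr p) = p.[0]%:~R + N%:R * z%:~R.
Proof.
have -> : scaled_gaussE (map_poly intr p) =
    \sum_(i < size p) (p`_i)%:~R * (N%:R ^+ i * (gauss_moment i)%:R).
  rewrite -[in LHS](coefK p) poly_def !rmorph_sum linear_sum; apply: eq_bigr => i _.
  by rewrite /= map_polyZ/= map_polyXn linearZ/= scaled_gaussEXn.
rewrite horner_coef0.
case: (size p) (nth_default 0 (leqnn (size p))) => [->|n _].
  by exists 0; rewrite big_ord0 mulr0 addr0.
exists (\sum_(i < n) p`_i.+1 * (N%:Z ^+ i * (gauss_moment i.+1)%:Z)).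
rewrite big_ord_recl/= expr0 !mulr1 rmorph_sum mulr_sumr; congr (_ + _).
apply: eq_bigr => i _; rewrite /bump/= add1n exprS !rmorphM rmorphXn/= -!pmulrn.
by ring.
Qed.
End scaled_functional.

Lemma big_flatten_nseq (V : nmodType) (T I : Type) (r : seq I) (n : I -> nat)
    (x : I -> T) (f : T -> V) :
  \sum_(y <- flatten [seq nseq (n i) (x i) | i <- r]) f y = \sum_(i <- r) f (x i) *+ n i.
Proof.
rewrite big_flatten big_map; apply: eq_bigr => i _.
by rewrite big_nseq -Monoid.iteropE.
Qed.

(** A multiset of integers of prime cardinality P has equal weights 1 / P; its
    moments are those of N times a standard Gaussian variable. *)
Lemma gauss_multiset (R : realType) (t : nat) : exists (s : seq int) (N : nat),
  [/\ prime (size s), (0 < N)%N & forall k, (k <= t)%N ->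
    \sum_(y <- s) y%:~R ^+ k =
    (size s)%:R * (N%:R ^+ k * (gauss_moment k)%:R) :> R].
Proof.
pose z (j : 'I_t.+1) : R := (j : nat)%:R.
have injz : injective z by move=> i j /eqP; rewrite eqr_nat => /eqP/val_inj.
(* The correction nodes are z_j = j, with Lagrange denominators d_j; D clears all
   of them. *)
pose d (j : 'I_t.+1) : int := \prod_(k | k != j) (j%:Z - k%:Z).
have dE j : (nodal z j).[z j] = (d j)%:~R.
  rewrite hornerX_nodal rmorph_prod; apply: eq_bigr => k _.
  by rewrite rmorphB.
have d0 j : (d j)%:~R != 0 :> R by rewrite -dE nodal_neq0.
pose D : nat := \prod_j `|d j|%N.
have D0 : (0 < D)%N.
  by rewrite prodn_gt0// => j; rewrite absz_gt0; have := d0 j; rewrite intr_eq0.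
have Dd j : D%:R / (d j)%:~R \is a @Num.int R.
  have /dvdzP[c cE] : (d j %| D%:Z)%Z by rewrite dvdzE /D (bigD1 j)//= dvdn_mulr.
  by rewrite -[D%:R]/(D%:Z%:~R) cE intrM mulfK.
pose nodZ j : {poly int} := \prod_(k : 'I_t.+1 | k != j) ('X - (k%:Z)%:P).
have nodE j : nodal z j = map_poly intr (nodZ j).
  rewrite rmorph_prod; apply: eq_bigr => k _.
  by rewrite /= rmorphB/= map_polyX map_polyC.
have lagE j : lagrange_basis z j = (d j)%:~R^-1 *: nodal z j by rewrite /lagrange_basis dE.
have [N [Y [N0 DN injY w0]]] := gauss_integer_nodes R t.+1 D0.
pose y i : R := (Y i)%:~R; pose l := lagrange_basis y; pose w i := scaled_gaussE N (l i).
(* Mass e is set apart at each z_j; e is small enough for the weights w'_i left at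
   the y_i to stay nonnegative. *)
pose S i := \sum_j (l i).[z j].
pose E := 1 + \sum_i `|S i| / w i.
have E0 : 0 < E.
  by rewrite ltr_wpDr ?ltr01// sumr_ge0// => i _; rewrite divr_ge0// ltW// w0.
pose e := E^-1; have e0 : 0 < e by rewrite invr_gt0.
pose w' i := w i - e * S i.
have w'0 i : 0 <= w' i.
  rewrite subr_ge0 (le_trans (ler_norm _))// normrM gtr0_norm//.
  rewrite mulrC ler_pdivrMr// -ler_pdivrMl ?w0//.
  rewrite mulrC /E (bigD1 i)//= addrCA lerDl addr_ge0// sumr_ge0// => j _.
  by rewrite divr_ge0// ltW// w0.
have rule (p : {poly R}) : (size p <= t.+1)%N ->
    scaled_gaussE N p = \sum_i w' i * p.[y i] + e * \sum_j p.[z j].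
  move=> sp; have pE := interpolation injY sp.
  have -> : scaled_gaussE N p = \sum_i p.[y i] * w i.
    by rewrite {1}pE linear_sum/=; apply: eq_bigr => i _; rewrite linearZ.
  have -> : \sum_j p.[z j] = \sum_i p.[y i] * S i.
    under eq_bigr do rewrite {1}pE horner_sum.
    rewrite exchange_big/=; apply: eq_bigr => i _; rewrite mulr_sumr.
    by apply: eq_bigr => j _; rewrite hornerZ.
  rewrite mulr_sumr -big_split/=; apply: eq_bigr => i _.
  by rewrite /w'; ring.
(* The prime P is large enough for the reserve P e to absorb the rounding errors,
   which are at most D at each of the nodes y_i. *)
pose B := \sum_j \sum_i `|(lagrange_basis z j).[y i]|.
have [P Pbig pP] := prime_above (Num.bound (D%:R * B / e)).
have B0 : 0 <= B by rewrite sumr_ge0// => j _; rewrite sumr_ge0.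
have PB : D%:R * B <= P%:R * e.
  rewrite -ler_pdivrMr// ltW// (lt_trans (archi_boundP _)) ?ltr_nat//.
  by rewrite divr_ge0 ?mulr_ge0// ltW.
have DR : 0 < D%:R :> R by rewrite ltr0n.
pose n i := (D * Num.truncn (P%:R * w' i / D%:R))%N.
pose r i := P%:R * w' i - (n i)%:R.
have r_bound i : 0 <= r i <= D%:R.
  have := truncn_itv (_ : 0 <= P%:R * w' i / D%:R).
  rewrite divr_ge0 ?mulr_ge0// => /(_ isT)/andP[].
  rewrite ler_pdivlMr// ltr_pdivrMr// /r /n natrM -natr1 => lo /ltW hi.
  by rewrite subr_ge0 lerBlDr mulrC lo/=; move: hi; rewrite mulrDl mul1r addrC mulrC.
(* Rounding P w'_i down to the multiple n_i of D leaves the defect M_j at z_j. *)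
pose M j := P%:R * scaled_gaussE N (lagrange_basis z j) -
  \sum_i (n i)%:R * (lagrange_basis z j).[y i].
have slag j : (size (lagrange_basis z j) <= t.+1)%N.
  by rewrite (leq_trans (size_scale_leq _ _))// size_nodal.
have ME j : M j = \sum_i r i * (lagrange_basis z j).[y i] + P%:R * e.
  have -> : M j = P%:R * (\sum_i w' i * (lagrange_basis z j).[y i] + e * 1) -
      \sum_i (n i)%:R * (lagrange_basis z j).[y i].
    rewrite /M rule//; congr (_ * (_ + e * _) - _).
    rewrite (bigD1 j)//= lagrange_basisE// eqxx big1 ?addr0// => k kj.
    by rewrite lagrange_basisE// eq_sym (negPf kj).
  rewrite mulr1 mulrDr addrAC mulr_sumr -sumrB; congr (_ + _).
  by apply: eq_bigr => i _; rewrite /r; ring.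
have M0 j : 0 <= M j.
  rewrite ME addrC -lerBlDr sub0r (le_trans _ PB)// /B [X in _ <= _ * X](bigD1 j)//= mulrDr.
  rewrite ler_wpDr// ?mulr_ge0 ?sumr_ge0// => [k _|]; first by rewrite sumr_ge0.
  rewrite -sumrN mulr_sumr ler_sum// => i _.
  rewrite (le_trans (ler_norm _))// normrN normrM ler_wpM2r//.
  by have /andP[? ?] := r_bound i; rewrite ger0_norm.
(* P E[l_j(N G)] is congruent to P l_j(0), and l_j(0) is 0 or 1, because D divides
   N; D also divides each n_i. *)
have MZ j : M j \is a Num.int.
  rewrite rpredB//.
    rewrite rpredM ?natr_int// lagE linearZ/= nodE; have [u ->] := scaled_gaussE_int R N (nodZ j).
    rewrite mulrDr; apply: rpredD.
      have := lagrange_basisE j ord0 injz.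
      rewrite lagE hornerZ nodE -[z _]/(0%:~R) horner_map => ->.
      exact: natr_int.
    rewrite mulrA rpredM ?intr_int//; have /dvdnP[c ->] := DN.
    by rewrite natrM mulrCA rpredM ?natr_int// mulrC.
  apply: rpred_sum => i _; rewrite lagE hornerZ nodE horner_map /n natrM mulrAC.
  by rewrite rpredM ?natr_int// mulrA rpredM ?intr_int// Dd.
have natM j : M j \is a Num.nat by rewrite natrEint MZ M0.
pose m j := Num.truncn (M j).
have mM j : (m j)%:R = M j by rewrite /m truncnK.
pose s : seq int := flatten [seq nseq (n i) (Y i) | i <- enum 'I_t.+1] ++
  flatten [seq nseq (m j) j%:Z | j : 'I_t.+1 <- enum 'I_t.+1].
have sumE (p : {poly R}) : (size p <= t.+1)%N ->
    \sum_(u <- s) p.[u%:~R] = P%:R * scaled_gaussE N p.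
  move=> sp; rewrite big_cat !big_flatten_nseq/= !big_enum/=.
  have -> : scaled_gaussE N p = \sum_j p.[z j] * scaled_gaussE N (lagrange_basis z j).
    rewrite {1}(interpolation injz sp) linear_sum/=; apply: eq_bigr => j _.
    by rewrite linearZ.
  have -> : \sum_i p.[(Y i)%:~R] *+ n i =
      \sum_j p.[z j] * (\sum_i (n i)%:R * (lagrange_basis z j).[y i]).
    under [RHS]eq_bigr do rewrite mulr_sumr.
    rewrite exchange_big; apply: eq_bigr => i _.
    rewrite {1}(interpolation injz sp) horner_sum -mulr_natl mulr_sumr.
    by apply: eq_bigr => j _; rewrite hornerZ -/(y i); ring.
  rewrite mulr_sumr -big_split/=; apply: eq_bigr => j _.
  by rewrite -[_ *+ m j]mulr_natl mM /M -[j%:Z%:~R]/(z j); ring.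
have size_s : size s = P.
  apply/eqP; rewrite -(eqr_nat R).
  have := sumE 'X^0; rewrite size_polyXn => /(_ isT).
  under eq_bigr do rewrite hornerXn expr0.
  rewrite scaled_gaussEXn expr0 !mulr1 => <-.
  by rewrite big_const_seq count_predT -Monoid.iteropE.
exists s, N; split; rewrite ?size_s// => k kt.
rewrite -scaled_gaussEXn -sumE ?size_polyXn//.
by apply: eq_bigr => u _; rewrite hornerXn.
Qed.

(** * Gilbert-Varshamov codes *)

Section gilbert_varshamov.
Context (F : finFieldType) (t r : nat).

(** Any t + 1 of the vectors v_0, ..., v_(n-1) are linearly independent.  The
    successor keeps the number t of old vectors that a new vector must avoid free
    of subtractions. *)
Definition wise_independent n (v : nat -> 'rV[F]_r) := forall c : nat -> F,
  (count (fun i => c i != 0%R) (iota 0 n) <= t.+1)%N ->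
  \sum_(0 <= i < n) c i *: v i = 0 -> forall i, (i < n)%N -> c i = 0.

(** A vector outside all combinations of t earlier ones extends the family; these
    combinations are counted with repetition, as t-tuples of pairs of an index and
    a coefficient. *)
Lemma gilbert_varshamov d n : (n <= d)%N -> ((d * #|F|) ^ t < #|F| ^ r)%N ->
  exists v, wise_independent n v.
Proof.
move=> nd lt_dr; elim: n nd => [|n IHn] nd; first by exists (fun=> 0) => c _ _ i.
have [v vI] := IHn (ltnW nd).
pose comb (h : {ffun 'I_t -> 'I_d * F}) := \sum_k (h k).2 *: v (h k).1.
pose combs : {set 'rV[F]_r} := [set comb h | h : {ffun 'I_t -> 'I_d * F}]%SET.
have [w wN] : exists w, w \notin combs.
  apply/existsP; rewrite -negb_forall; apply/negP => /forallP all_comb.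
  have : (#|'rV[F]_r| <= #|combs|)%N.
    by apply/subset_leq_card/fintype.subsetP => w _; have := all_comb w.
  apply/negP; rewrite -ltnNge (leq_ltn_trans (leq_imset_card _ _))//.
  by rewrite card_ffun card_prod !card_ord card_mx mul1n.
exists (fun i => if i == n then w else v i) => c.
rewrite -{1}addn1 iotaD add0n count_cat /= addn0 => cc.
rewrite big_nat_recr//= eqxx (eq_big_nat _ _ (F2 := fun i => c i *: v i)); last first.
  by move=> i /andP[_ ltin]; rewrite ltn_eqF.
have [cn0|cn0] := eqVneq (c n) 0.
  rewrite cn0 scale0r addr0 => s0 i; rewrite ltnS leq_eqVlt => /predU1P[->//|].
  by apply: vI s0 i; rewrite (leq_trans _ cc)// leq_addr.
move=> s0; case/negP: wN; apply/imsetP.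
(* A dependency involving w expresses it through the at most t other vectors of
   its support; the combination is padded with zero coefficients. *)
pose s := [seq i <- iota 0 n | c i != 0].
have sd i : (i < t)%N -> (nth 0%N s i < d)%N.
  move=> _; have [si|si] := ltnP i (size s); last by rewrite nth_default// (leq_ltn_trans _ nd).
  have := mem_nth 0%N si; rewrite mem_filter mem_iota => /andP[_ /andP[_ lt_in]].
  exact: ltn_trans lt_in nd.
have st : (size s <= t)%N by move: cc; rewrite size_filter cn0 addn1.
exists [ffun k : 'I_t => (Ordinal (sd k (ltn_ord k)),
   if (k < size s)%N then - ((c n)^-1 * c (nth 0%N s k)) else 0)] => //.
rewrite /comb; under eq_bigr do rewrite ffunE/=.
have -> : w = - ((c n)^-1 *: \sum_(0 <= i < n) c i *: v i).
  move/eqP: s0; rewrite addrC addr_eq0 => /eqP s0.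
  by rewrite -scalerN -s0 scalerA mulVf ?scale1r.
have -> : \sum_(0 <= i < n) c i *: v i = \sum_(i <- s) c i *: v i.
  rewrite big_filter /index_iota subn0 [LHS](bigID (fun i => c i != 0))/= addrC big1 ?add0r// => i.
  by rewrite negbK => /eqP->; rewrite scale0r.
rewrite (big_nth 0%N) big_mkord (big_ord_widen t (fun i => c (nth 0%N s i) *: v (nth 0%N s i)))//.
rewrite scaler_sumr -sumrN big_mkcond; apply: eq_bigr => k _.
by case: ifP => _; rewrite ?scale0r// scalerA scaleNr.
Qed.
End gilbert_varshamov.

Section independent_moments.
Context (F : finFieldType) (t r d : nat) (v : nat -> 'rV[F]_r).
Context (vI : wise_independent t d v).

Definition dotp (u w : 'rV[F]_r) : F := (u *m w^T) 0 0.

Lemma dotpDl u1 u2 w : dotp (u1 + u2) w = dotp u1 w + dotp u2 w.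
Proof. by rewrite /dotp mulmxDl mxE. Qed.

Lemma dotpZl a u w : dotp (a *: u) w = a * dotp u w.
Proof. by rewrite /dotp -scalemxAl mxE. Qed.

Lemma dual_vector (S : {set 'I_d}) i : (#|S| <= t.+1)%N -> i \in S ->
  exists e, forall j, j \in S -> dotp e (v j) = (i == j)%:R.
Proof.
move=> cS iS; pose A := \matrix_(k < #|S|) v (enum_val k).
have /row_freeP[B AB] : row_free A.
  apply: inj_row_free => u uA0; apply/rowP => k; rewrite mxE.
  pose c i := \sum_(k < #|S|) if enum_val k == i :> nat then u 0 k else 0.
  have cE (k' : 'I_#|S|) : c (val (enum_val k')) = u 0 k'.
    rewrite /c (bigD1 k')//= eqxx big1 ?addr0// => k'' kk; case: eqP => // /val_inj/enum_val_inj kE.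
    by rewrite kE eqxx in kk.
  rewrite -cE; apply: (vI (c := c)) => //.
  - rewrite (leq_trans _ cS)// -size_filter.
    have /uniq_leq_size : uniq [seq i <- iota 0 d | c i != 0] by rewrite filter_uniq// iota_uniq.
    move=> /(_ [seq val j | j <- enum S]); rewrite size_map -cardE; apply.
    move=> j; rewrite mem_filter => /andP[cj _].
    suff [k' kj] : exists k' : 'I_#|S|, enum_val k' == j :> nat.
      apply/mapP; exists (enum_val k'); last exact/esym/eqP.
      by rewrite mem_enum enum_valP.
    apply/existsP; apply: contraNT cj; rewrite negb_exists => /forallP nj.
    by rewrite /c big1// => k' _; rewrite (negPf (nj k')).
  - move: uA0; rewrite mulmx_sum_row => uA0; rewrite -[RHS]uA0.
    under [RHS]eq_bigr do rewrite rowK.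
    rewrite big_mkord (eq_bigr (fun j : 'I_d =>
      \sum_(k < #|S|) (if enum_val k == j :> nat then u 0 k else 0) *: v j)); last first.
      by move=> j _; rewrite scaler_suml.
    rewrite exchange_big; apply: eq_bigr => k' _ /=.
    rewrite (bigD1 (enum_val k'))//= eqxx big1 ?addr0// => j jk.
    by rewrite eq_sym val_eqE (negPf jk) scale0r.
  - exact: ltn_ord.
exists (col (enum_rank_in iS i) B)^T => j jS.
have <- : (A *m B) (enum_rank_in iS j) (enum_rank_in iS i) = (i == j)%:R.
  rewrite AB mxE; congr (nat_of_bool _)%:R; apply/eqP/eqP => [/(congr1 enum_val)|ij].
    by rewrite !enum_rankK_in.
  by apply: enum_val_inj; rewrite !enum_rankK_in.
rewrite /dotp -trmx_mul mxE !mxE; apply: eq_bigr => k _.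
by rewrite !mxE enum_rankK_in.
Qed.

(** For u uniform, the scalars u . v_i with i in S are independent and uniform.
    Translating u along the vector dual to v_i averages the factor of i without
    affecting the others, which gives an induction on S. *)
Lemma independent_moments (K : comNzRingType) (S : {set 'I_d}) (f : 'I_d -> F -> K) :
  (#|S| <= t.+1)%N ->
  (#|F| ^ #|S|)%:R * \sum_u \prod_(i in S) f i (dotp u (v i)) =
  (#|F| ^ r)%:R * \prod_(i in S) \sum_a f i a.
Proof.
have [m] := ubnP #|S|; elim: m S => // m IHm S mS cS.
have [->|[i iS]] := set_0Vmem S.
  rewrite cards0 expn0 mul1r !big_set0 mulr1.
  by under eq_bigr do rewrite big_set0; rewrite sumr_const card_mx mul1n.
have [e eE] := dual_vector cS iS.
have cSi : #|S| = #|S :\ i|.+1 by rewrite (cardsD1 i) iS.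
rewrite [in RHS](big_setD1 i)//= mulrCA -IHm; last 2 first.
- by rewrite -cSi in mS *.
- by rewrite (leq_trans _ cS)// cSi.
rewrite cSi expnS natrM -mulrA mulrCA [RHS]mulrCA; congr (_ * _).
rewrite mulr_natl -[#|F|]/(#|predT : pred F|) -sumr_const.
rewrite [LHS](eq_bigr (fun a => \sum_u f i (dotp u (v i) + a) *
    \prod_(j in S :\ i) f j (dotp u (v j)))); last first.
  move=> a _; rewrite (reindex_inj (addIr (a *: e))).
  apply: eq_bigr => u _; rewrite (big_setD1 i)//=.
  rewrite dotpDl dotpZl eE// eqxx mulr1; congr (_ * _).
  apply: eq_bigr => j; rewrite in_setD1 => /andP[ji jS].
  by rewrite dotpDl dotpZl eE// eq_sym (negPf ji) mulr0 addr0.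
rewrite exchange_big [RHS]mulr_sumr; apply: eq_bigr => u _.
rewrite -mulr_suml; congr (_ * _).
by rewrite [RHS](reindex_inj (addrI (dotp u (v i)))).
Qed.
End independent_moments.

(** * Lebesgue measure on tuples *)

Section tuple_integral.
Context (R : realType).
Local Notation mR := (measurableTypeR R).
Local Notation mu := (@lebesgue_measure R).
Local Open Scope ereal_scope.

Lemma ge0_integral_lebesgue_tupleS n (f : n.+1.-tuple mR -> \bar R) :
  measurable_fun setT f -> (forall x, 0 <= f x) ->
  \int[lebesgue_tuple R n.+1]_x f x =
  \int[mu]_a \int[lebesgue_tuple R n]_x f (cons_pair (a, x)).
Proof.
move=> mf f0.
transitivity (\int[pushforward (mu \x lebesgue_tuple R n) (@cons_pair R n)]_x f x).
  by apply: eq_measure_integral; first exact: measurable_cons_pair.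
rewrite ge0_integral_pushforward//; last exact: measurable_cons_pair.
rewrite preimage_setT fubini_tonelli1//.
- by apply: measurableT_comp => //; exact: measurable_cons_pair.
- by move=> x; exact: f0.
Qed.

Lemma ge0_integral_lebesgue_tuple_prod n (phi : 'I_n -> mR -> R) :
  (forall i, measurable_fun setT (phi i)) -> (forall i a, (0 <= phi i a)%R) ->
  \int[lebesgue_tuple R n]_x (\prod_(i < n) phi i (tnth x i))%:E =
  \prod_(i < n) \int[mu]_a (phi i a)%:E.
Proof.
elim: n phi => [|n IHn] phi mphi phi0.
  rewrite /= integral_dirac//.
    by rewrite !big_ord0 diracT mule1.
  under eq_fun do rewrite big_ord0.
  exact: measurable_cst.
have mprod k (psi : 'I_k -> mR -> R) : (forall i, measurable_fun setT (psi i)) ->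
    measurable_fun [set: k.-tuple mR] (fun x => (\prod_(i < k) psi i (tnth x i))%:E).
  move=> mpsi; apply/measurable_EFinP; apply: measurable_prod => i _.
  by apply: measurableT_comp => //; exact: measurable_tnth.
rewrite ge0_integral_lebesgue_tupleS//; last 2 first.
- exact: mprod.
- by move=> x; rewrite lee_fin prodr_ge0.
transitivity (\int[mu]_a ((phi ord0 a)%:E *
    \prod_(i < n) \int[mu]_b (phi (lift ord0 i) b)%:E)).
  apply: eq_integral => a _; rewrite -IHn// -ge0_integralZl//; last 3 first.
  - exact: (mprod n (fun i => phi (lift ord0 i))).
  - by move=> x _; rewrite lee_fin prodr_ge0.
  - by rewrite lee_fin.
  apply: eq_integral => x _; rewrite -EFinM big_ord_recl; congr (_ * _)%:E.
  by apply: eq_bigr => i _; rewrite tnthS.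
rewrite ge0_integralZr//; last 3 first.
- exact/measurable_EFinP.
- by move=> a _; rewrite lee_fin.
- by apply: prode_ge0 => i _; apply: integral_ge0 => a _; rewrite lee_fin.
by rewrite big_ord_recl.
Qed.

Lemma lebesgue_measure_scale (c : R) (A : set mR) : (0 < c)%R -> measurable A ->
  lebesgue_measure A = c%:E * lebesgue_measure ((fun a : mR => c * a : mR)%R @^-1` A).
Proof.
move=> c0 mA.
have mc : measurable_fun setT (fun a : mR => c * a : mR)%R by exact: measurable_funM.
pose nu : {measure set mR -> \bar R} := mscale (NngNum (ltW c0))
  (measure_function_pushforward__canonical__measure_function_Measure mu mc).
rewrite (lebesgue_measure_unique (mu := nu))// => _ [[a b]] _ <-.
rewrite /nu /= /mscale/= /pushforward.
have -> : (fun a : mR => c * a : mR)%R @^-1` `]a, b] = `](a / c)%R, (b / c)%R]%classic.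
  apply/seteqP; split=> x /=; rewrite !in_itv/= ltr_pdivrMr// ler_pdivlMr//.
    by rewrite ![(x * c)%R]mulrC.
  by rewrite ![(x * c)%R]mulrC.
rewrite !lebesgue_measure_itv/= !lte_fin ltr_pM2r ?invr_gt0//.
case: ifP => _; last by rewrite mule0.
by rewrite -!EFinB -EFinM mulrBr !(mulrCA c) divff ?gt_eqF// !mulr1.
Qed.

Lemma ge0_integral_scale1 (c : R) (f : mR -> \bar R) : c != 0%R ->
  measurable_fun setT f -> (forall a, 0 <= f a) ->
  \int[mu]_a f a = `|c|%:E * \int[mu]_a f (c * a)%R.
Proof.
have pos (b : R) (g : mR -> \bar R) : (0 < b)%R -> measurable_fun setT g -> (forall a, 0 <= g a) ->
    \int[mu]_a g a = b%:E * \int[mu]_a g (b * a)%R.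
  move=> b0 mg g0.
  have mb : measurable_fun setT (fun a : mR => b * a : mR)%R by exact: measurable_funM.
  pose nu : {measure set mR -> \bar R} :=
    measure_function_pushforward__canonical__measure_function_Measure mu mb.
  transitivity (\int[mscale (NngNum (ltW b0)) nu]_a g a).
    apply: eq_measure_integral => // A mA _.
    exact: (lebesgue_measure_scale b0 mA).
  by rewrite ge0_integral_mscale//= ge0_integral_pushforward.
have neg (g : mR -> \bar R) : measurable_fun setT g -> (forall a, 0 <= g a) ->
    \int[mu]_a g a = \int[mu]_a g (- a)%R.
  move=> mg g0.
  transitivity (\int[pushforward mu (-%R : mR -> mR)]_a g a).
    by apply: eq_measure_integral => // A mA _; rewrite [RHS]lebesgue_measureN.
  by rewrite ge0_integral_pushforward.
move=> c0 mf f0; have [c_lt|c_gt|] := ltgtP c 0%R; last by move=> c00; rewrite c00 eqxx in c0.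
- rewrite (pos (- c)%R)//; last by rewrite oppr_gt0.
  rewrite ltr0_norm// [in LHS]neg//; last by apply: measurableT_comp => //; exact: measurable_funM.
  by congr (_ * _); apply: eq_integral => a _; rewrite mulrNN.
- by rewrite (pos c)// gtr0_norm.
Qed.

(** Coordinatewise scaling serves both for dilations and for reflections. *)
Definition tscale n (c : 'I_n -> R) (x : n.-tuple mR) : n.-tuple mR :=
  [tuple (c i * tnth x i)%R | i < n].

Lemma measurable_tscale n (c : 'I_n -> R) : measurable_fun setT (tscale c).
Proof.
apply/measurable_fun_tnthP => i.
rewrite (_ : _ \o _ = fun x => (c i * tnth x i)%R); last first.
  by apply/funext => x /=; rewrite tnth_mktuple.
by apply: measurable_funM => //; exact: measurable_tnth.
Qed.

Lemma ge0_integral_tscale n (c : 'I_n -> R) (f : n.-tuple mR -> \bar R) :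
  (forall i, c i != 0%R) -> measurable_fun setT f -> (forall x, 0 <= f x) ->
  \int[lebesgue_tuple R n]_x f x =
  (\prod_(i < n) `|c i|)%:E * \int[lebesgue_tuple R n]_x f (tscale c x).
Proof.
elim: n c f => [|n IHn] c f c0 mf f0.
  rewrite big_ord0 mul1e; apply: eq_integral => x _; congr f.
  by rewrite [RHS]tuple0 [LHS]tuple0.
have mfc : measurable_fun setT (f \o @cons_pair R n).
  by apply: measurableT_comp => //; exact: measurable_cons_pair.
have mfa a : measurable_fun setT (fun x => f (cons_pair (a, x))).
  exact: (measurableT_comp mfc).
rewrite !ge0_integral_lebesgue_tupleS//; last first.
  by apply: measurableT_comp => //; exact: measurable_tscale.
rewrite (@ge0_integral_scale1 (c ord0))//; last 2 first.
- apply: (measurable_fun_fubini_tonelli_F (m2 := lebesgue_tuple R n)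
    (f \o @cons_pair R n)) => // x; exact: f0.
- by move=> a; apply: integral_ge0.
rewrite big_ord_recl EFinM -muleA; congr (_ * _).
rewrite -ge0_integralZl//; last 3 first.
- apply: (measurable_fun_fubini_tonelli_F (m2 := lebesgue_tuple R n)
    (f \o tscale c \o @cons_pair R n)) => [|x]; last exact: f0.
  apply: measurableT_comp; last exact: measurable_cons_pair.
  by apply: measurableT_comp => //; exact: measurable_tscale.
- by move=> a _; exact: integral_ge0.
- by rewrite lee_fin prodr_ge0.
apply: eq_integral => a _.
rewrite (IHn (fun i => c (lift ord0 i)))//; congr (_ * _).
apply: eq_integral => x _; congr f; apply: eq_from_tnth => i.
rewrite tnth_mktuple; case: (unliftP ord0 i) => [j ->|->]; last by rewrite !tnth0.
by rewrite !tnthS tnth_mktuple.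
Qed.
End tuple_integral.

(** * Polar coordinates *)

Section radial_integral.
Context (R : realType) (n : nat).
Local Notation mR := (measurableTypeR R).
Local Notation mu := (@lebesgue_measure R).
Local Notation leb := (lebesgue_tuple R n.+1).
Local Notation T := (n.+1.-tuple mR).
Local Open Scope ereal_scope.

Lemma enorm_ge0 d (x : d.-tuple mR) : (0 <= enorm x)%R.
Proof. exact: sqrtr_ge0. Qed.

Lemma enorm_tscale d (r : R) (x : d.-tuple mR) : (0 <= r)%R ->
  enorm (tscale (fun=> r) x) = (r * enorm x)%R.
Proof.
move=> r0; rewrite /enorm; under eq_bigr do rewrite tnth_mktuple exprMn.
by rewrite -mulr_sumr sqrtrM ?sqr_ge0// sqrtr_sqr ger0_norm.
Qed.

(** With d = n + 1, integrating shell (r |x|) over r gives a multiple of 1 / |x|,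
    while shell (|x|) is supported on the unit ball. *)
Definition shell (s : mR) : R := (s ^+ n * \1_(`]0%R, 1%R]%classic : set mR) s)%R.

(** The profile g seen after the substitution x -> x / r, with the Jacobian
    r^-(n+1) and one more r^-1 from the factor |x| of the double integral below. *)
Definition inverted_radial (g : mR -> R) (r : mR) (rho : mR) : R :=
  (\1_(`]0%R, +oo[%classic : set mR) r * r^-1 ^+ n.+2 * g (rho / r))%R.

Lemma measurable_shell : measurable_fun [set: mR] shell.
Proof.
by apply: measurable_funM; [exact: measurable_funX|exact: measurable_indic].
Qed.

Lemma shell_ge0 s : (0 <= shell s)%R.
Proof.
rewrite /shell indicE; case: (boolP (s \in _)) => [|_]; last by rewrite mulr0.
by rewrite inE/= in_itv/= mulr1 => /andP[/ltW s0 _]; rewrite exprn_ge0.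
Qed.

Lemma measurable_invr : measurable_fun [set: R] (@GRing.inv R).
Proof.
rewrite (_ : GRing.inv = fun x : R => (x * (x ^+ 2) `^ (-1))%R); last first.
  apply/funext => x; rewrite powR_inv1 ?sqr_ge0//.
  have [->|x0] := eqVneq x 0%R; first by rewrite invr0 mul0r.
  by rewrite expr2 invfM mulrA divff// mul1r.
apply: measurable_funM => //.
apply: (@measurableT_comp _ _ _ _ _ _ (@powR R ^~ (-1)%R)); last exact: measurable_funX.
exact: measurable_powR.
Qed.

Lemma measurable_inverted_radialT d (U : measurableType d) (g : mR -> R) (a b : U -> mR) :
  measurable_fun setT g -> measurable_fun setT a -> measurable_fun setT b ->
  measurable_fun setT (fun u => inverted_radial g (a u) (b u)).
Proof.
move=> mg ma mb.
have mia : measurable_fun setT (fun u => (a u)^-1%R : mR).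
  by apply: measurableT_comp => //; exact: measurable_invr.
apply: measurable_funM.
  apply: measurable_funM.
    by apply: measurableT_comp => //; exact: measurable_indic.
  exact: measurable_funX.
by apply: measurableT_comp => //; exact: measurable_funM.
Qed.

Lemma measurable_shellT d (U : measurableType d) (a : U -> mR) :
  measurable_fun setT a -> measurable_fun setT (fun u => shell (a u)).
Proof. by move=> ma; apply: measurableT_comp => //; exact: measurable_shell. Qed.

Lemma inverted_radial_ge0 (g : mR -> R) r rho : (forall u, (0 <= g u)%R) ->
  (0 <= inverted_radial g r rho)%R.
Proof.
move=> g0; rewrite /inverted_radial indicE.
have [|_] := boolP (r \in _); last by rewrite !mul0r.
by rewrite inE/= in_itv/= andbT => r0; rewrite mul1r mulr_ge0// exprn_ge0// invr_ge0 ltW.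
Qed.

(** Passage from a radial profile g to the unit ball for a function h of the
    direction only.  Integrate h(x) g(|x|) |x| shell(r |x|) over x and r > 0: for
    fixed x the integral over r is h(x) g(|x|) times a constant; after the dilation
    x -> x / r it is h(x) on the unit ball times another constant.  Neither
    constant depends on h, so that comparing two functions h eliminates them. *)
Lemma ge0_integral_radial (g : mR -> R) (h : T -> R) :
  measurable_fun setT g -> (forall r, (0 <= g r)%R) ->
  measurable_fun setT h -> (forall x, (0 <= h x)%R) ->
  (forall r x, (0 < r)%R -> h (tscale (fun=> r) x) = h x) ->
  (forall x, enorm x = 0%R -> h x = 0%R) ->
  \int[leb]_x (h x * g (enorm x))%:E * \int[mu]_s (shell s)%:E =
  \int[leb]_x (h x * \1_(@unit_ball R n.+1) x)%:E * \int[mu]_r (inverted_radial g r 1)%:E.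
Proof.
move=> mg g0 mh h0 hr hz.
have mE := @measurable_enorm R n.+1.
have inv_ge0 r rho : (0 <= inverted_radial g r rho)%R by exact: inverted_radial_ge0.
pose Phi (p : mR * T) := (h p.2 * (g (enorm p.2) * enorm p.2 * shell (p.1 * enorm p.2)))%:E.
pose Psi (p : mR * T) :=
  (h p.2 * (shell (enorm p.2) * enorm p.2 * inverted_radial g p.1 (enorm p.2)))%:E.
have mE2 : measurable_fun setT (fun p : mR * T => enorm p.2 : mR).
  by apply: measurableT_comp.
have mh2 : measurable_fun setT (fun p : mR * T => h p.2) by exact: measurableT_comp.
have mPhi : measurable_fun setT Phi.
  apply/measurable_EFinP; apply: measurable_funM => //; apply: measurable_funM.
    by apply: measurable_funM => //; exact: measurableT_comp.
  by apply: measurable_shellT; exact: measurable_funM.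
have mPsi : measurable_fun setT Psi.
  apply/measurable_EFinP; apply: measurable_funM => //; apply: measurable_funM.
    by apply: measurable_funM => //; exact: measurable_shellT.
  exact: measurable_inverted_radialT.
have mPhi2 r : measurable_fun setT (fun x => Phi (r, x)).
  exact: (measurableT_comp mPhi (pair1_measurable r)).
have Phi0 p : 0 <= Phi p.
  rewrite /Phi lee_fin; apply: mulr_ge0 => //; apply: mulr_ge0; last exact: shell_ge0.
  by apply: mulr_ge0 => //; exact: enorm_ge0.
have Psi0 p : 0 <= Psi p.
  rewrite /Psi lee_fin; apply: mulr_ge0 => //; apply: mulr_ge0 => //.
  by apply: mulr_ge0; [exact: shell_ge0|exact: enorm_ge0].
have E1 x : \int[mu]_r Phi (r, x) = (h x * g (enorm x))%:E * \int[mu]_s (shell s)%:E.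
  have [E0|E0] := eqVneq (enorm x) 0%R.
    rewrite hz// mul0r mul0e integral0_eq// => r _.
    by rewrite /Phi/= hz// mul0r.
  rewrite [in RHS](ge0_integral_scale1 E0)//; last 2 first.
  - by apply/measurable_EFinP; exact: measurable_shell.
  - by move=> a; rewrite lee_fin shell_ge0.
  rewrite muleA -EFinM -ge0_integralZl//; last 3 first.
  - apply/measurable_EFinP; apply: measurableT_comp; first exact: measurable_shell.
    exact: measurable_funM.
  - by move=> a _; rewrite lee_fin shell_ge0.
  - by rewrite lee_fin !mulr_ge0.
  apply: eq_integral => r _; rewrite -EFinM /Phi/= ger0_norm ?enorm_ge0//.
  by congr _%:E; rewrite (mulrC r); ring.
have E2 r : \int[leb]_x Phi (r, x) = \int[leb]_x Psi (r, x).
  have [r0|r0] := leP r 0%R.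
    rewrite !integral0_eq// => x _; rewrite /Phi /Psi/=.
      rewrite /inverted_radial indicE memNset ?mul0r ?mulr0//=.
      by rewrite in_itv/= andbT; apply/negP; rewrite -leNgt.
    rewrite /shell indicE memNset ?mul0r ?mulr0//=.
    rewrite in_itv/= => /andP[+ _]; apply/negP; rewrite -leNgt.
    by rewrite mulr_le0_ge0 ?enorm_ge0.
  rewrite (@ge0_integral_tscale R _ (fun=> r^-1)%R)//; last first.
  - by move=> _; rewrite invr_eq0 gt_eqF.
  rewrite prodr_const card_ord -ge0_integralZl//; last first.
  - exact: (measurableT_comp (mPhi2 r) (measurable_tscale (fun=> r^-1)%R)).
  apply: eq_integral => x _; rewrite /Phi /Psi -EFinM/= hr ?invr_gt0//; congr _%:E.
  rewrite enorm_tscale ?invr_ge0 ?ltW// [X in shell X]mulrA divff ?gt_eqF// mul1r.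
  rewrite /inverted_radial indicE mem_set ?mul1r; last by rewrite /= in_itv/= r0.
  rewrite gtr0_norm ?invr_gt0// (mulrC (enorm x) r^-1%R) [(r^-1 ^+ n.+2)%R]exprS; ring.
have E3 x : \int[mu]_r Psi (r, x) =
    (h x * \1_(@unit_ball R n.+1) x)%:E * \int[mu]_r (inverted_radial g r 1)%:E.
  have [E0|E0] := eqVneq (enorm x) 0%R.
    rewrite hz// mul0r mul0e integral0_eq// => r _.
    by rewrite /Psi/= hz// mul0r.
  rewrite [in RHS](@ge0_integral_scale1 R (enorm x)^-1%R)//; last 3 first.
  - by rewrite invr_eq0.
  - by apply/measurable_EFinP; exact: measurable_inverted_radialT.
  - by move=> a; rewrite lee_fin.
  rewrite muleA -EFinM -ge0_integralZl//; last 3 first.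
  - by apply/measurable_EFinP; apply: measurable_inverted_radialT => //; exact: measurable_funM.
  - by move=> a _; rewrite lee_fin.
  - by rewrite lee_fin !mulr_ge0.
  have Egt : (0 < enorm x)%R by rewrite lt_neqAle eq_sym E0 enorm_ge0.
  apply: eq_integral => r _; rewrite -EFinM /Psi/= ger0_norm ?invr_ge0 ?enorm_ge0//.
  congr _%:E; rewrite /shell /inverted_radial !indicE.
  have -> : (enorm x \in `]0%R, 1%R]%classic) = (x \in @unit_ball R n.+1).
    by apply/idP/idP; rewrite !inE/= in_itv/= Egt.
  have -> : ((enorm x)^-1 * r \in `]0%R, +oo[%classic)%R = (r \in `]0%R, +oo[%classic).
    by apply/idP/idP; rewrite !inE/= !in_itv/= !andbT pmulr_rgt0// invr_gt0.
  have -> : (1 / ((enorm x)^-1 * r) = enorm x / r)%R by rewrite invfM invrK mul1r.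
  rewrite !invfM invrK exprMn.
  have -> : (enorm x ^+ n.+2 = enorm x ^+ n * enorm x * enorm x)%R by rewrite !exprSr.
  by field.
rewrite -!ge0_integralZr//; last 6 first.
- apply/measurable_EFinP; apply: measurable_funM => //.
  by apply: measurable_indic; exact: measurable_unit_ball.
- by move=> x _; rewrite lee_fin mulr_ge0.
- by apply: integral_ge0 => r _; rewrite lee_fin.
- by apply/measurable_EFinP; apply: measurable_funM => //; exact: measurableT_comp.
- by move=> x _; rewrite lee_fin mulr_ge0.
- by apply: integral_ge0 => s _; rewrite lee_fin shell_ge0.
transitivity (\int[leb]_x \int[mu]_r Phi (r, x)); first by apply: eq_integral => x _; rewrite E1.
transitivity (\int[leb]_x \int[mu]_r Psi (r, x)); last by apply: eq_integral => x _; rewrite E3.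
rewrite -(fubini_tonelli Phi)// -(fubini_tonelli Psi)//.
by apply: eq_integral => r _; exact: E2.
Qed.
End radial_integral.

(** * Gaussian integrals on the line *)

Section gauss_moments.
Context (R : realType).
Local Notation mR := (measurableTypeR R).
Local Notation mu := (@lebesgue_measure R).

Lemma gauss_fun_derive (x : R) : is_derive x 1 (fun y => - gauss_fun y) (2 * x * gauss_fun x).
Proof.
rewrite /gauss_fun; apply: is_derive_eq.
rewrite /GRing.scale/=. ring.
Qed.

Lemma tail_gauss (a : R) : 0 <= a ->
  (\int[mu]_(r in `[a, +oo[) (2 * r * gauss_fun r)%:E = (gauss_fun a)%:E)%E.
Proof.
move=> a0; have cF : continuous (fun y : R => - gauss_fun y).
  by move=> x; apply: cvgN; exact: continuous_gauss_fun.
rewrite (@ge0_continuous_FTC2y R _ (fun y => - gauss_fun y) a 0).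
- by rewrite sub0e EFinN oppeK.
- by move=> x ax; rewrite mulr_ge0 ?gauss_fun_ge0// mulr_ge0// (le_trans a0).
- apply: continuous_subspaceT => x; apply: cvgM; last exact: continuous_gauss_fun.
  by apply: cvgM; [exact: cvg_cst|exact: cvg_id].
- by rewrite -oppr0; apply: cvgN; exact: cvg_gauss_fun.
- by move=> x _; apply: ex_derive; exact: gauss_fun_derive.
- by apply: cvg_at_right_filter; exact: cF.
- by move=> x _; rewrite derive1E; apply: derive_val; exact: gauss_fun_derive.
Qed.

Lemma integral_pow (k : nat) (r : R) : 0 <= r ->
  (\int[mu]_(x in `[0%R, r]) (x ^+ k)%:E = (r ^+ k.+1 / k.+1%:R)%:E)%E.
Proof.
rewrite le_eqVlt => /predU1P[<-|r0].
  by rewrite set_itv1 integral_set1 expr0n mul0r.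
pose F (x : R) := k.+1%:R^-1 * x ^+ k.+1.
have dF (x : R) : is_derive x 1 F (x ^+ k).
  have -> : F = k.+1%:R^-1 \*: (id ^+ k.+1).
    by apply/funext => y; rewrite /F/= fctE.
  apply: is_derive_eq (is_deriveZ k.+1%:R^-1 (is_deriveX k.+1 (is_derive_id x (1 : R)))) _.
  by rewrite /GRing.scale/= mulr1 mulrA mulVf ?mul1r// pnatr_eq0.
have cF : continuous F.
  by move=> x; apply: cvgM; [exact: cvg_cst|exact: exprn_continuous].
rewrite (@continuous_FTC2 R _ F 0 r)//.
- by rewrite /F expr0n mulr0 sube0 mulrC.
- by apply: continuous_subspaceT => x; exact: exprn_continuous.
- split; first by move=> x _; apply: ex_derive; exact: dF.
    by apply: cvg_at_right_filter; exact: cF.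
  by apply: cvg_at_left_filter; exact: cF.
- by move=> x _; rewrite derive1E; apply: derive_val; exact: dF.
Qed.

Lemma integral_indicE (A : set mR) (f : mR -> R) :
  (\int[mu]_x (f x * \1_A x)%:E = \int[mu]_(x in A) (f x)%:E)%E.
Proof.
rewrite [RHS]integral_mkcond; apply: eq_integral => x _.
by rewrite patchE indicE; case: ifP => _; rewrite ?mulr1 ?mulr0.
Qed.

Definition half_moment k := (\int[mu]_(x in `[0%R, +oo[) (x ^+ k * gauss_fun x)%:E)%E.

(** Write exp(-x^2) as the integral of 2 r exp(-r^2) over r >= x and exchange the
    two integrals; this replaces an integration by parts, and all integrands are
    nonnegative. *)
Lemma half_momentSS k : half_moment k = ((2 / k.+1%:R)%:E * half_moment k.+2)%E.
Proof.
pose pos : set mR := `[0%R, +oo[%classic.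
pose Xi (p : mR * mR) :=
  ((p.1 ^+ k * \1_pos p.1) * (2 * p.2 * gauss_fun p.2 * \1_pos (p.2 - p.1)))%:E.
have mpos : measurable_fun setT (\1_pos : mR -> R) by rewrite /pos; exact: measurable_indic.
have posE x : \1_pos x = (0 <= x)%R%:R :> R.
  by rewrite indicE; congr (nat_of_bool _)%:R; apply/idP/idP; rewrite inE /pos/= in_itv/= andbT.
have mXi : measurable_fun setT Xi.
  apply/measurable_EFinP; apply: measurable_funM; apply: measurable_funM.
  - exact: measurable_funX.
  - exact: measurableT_comp.
  - apply: measurable_funM; first exact: measurable_funM.
    by apply: measurableT_comp => //; exact: measurable_gauss_fun.
  - by apply: measurableT_comp => //; exact: measurable_funB.
have Xi0 p : (0 <= Xi p)%E.
  rewrite /Xi lee_fin !posE; case: p => x r /=; rewrite subr_ge0.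
  have [x0|_] := leP 0 x; last by rewrite mulr0 mul0r.
  have [xr|_] := leP x r; last by rewrite !mulr0.
  by rewrite !mulr1 mulr_ge0 ?exprn_ge0// mulr_ge0 ?gauss_fun_ge0// mulr_ge0// (le_trans x0).
have mpow j : measurable_fun [set: mR] (fun x : mR => (x ^+ j * gauss_fun x * \1_pos x)%:E).
  apply/measurable_EFinP; apply: measurable_funM => //; apply: measurable_funM.
    exact: measurable_funX.
  exact: measurable_gauss_fun.
transitivity (\int[mu]_x \int[mu]_r Xi (x, r))%E.
  rewrite /half_moment -integral_indicE; apply: eq_integral => x _.
  rewrite /Xi/= posE; have [x0|x0] := leP 0 x; last first.
    by rewrite !mulr0 integral0_eq// => r _; rewrite mul0r.
  transitivity (\int[mu]_(r in `[x, +oo[) (x ^+ k * (2 * r * gauss_fun r))%:E)%E; last first.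
    rewrite -integral_indicE; apply: eq_integral => r _; rewrite mulr1 -mulrA posE indicE subr_ge0.
    congr (_ * (_ * (nat_of_bool _)%:R))%:E.
    by apply/idP/idP; rewrite inE/= in_itv/= andbT.
  under [RHS]eq_integral do rewrite EFinM.
  rewrite ge0_integralZl//; last 3 first.
  - apply/measurable_EFinP; apply: measurable_funTS; apply: measurable_funM.
      exact: measurable_funM.
    exact: measurable_gauss_fun.
  - move=> r; rewrite /= in_itv/= andbT => xr.
    by rewrite lee_fin mulr_ge0 ?gauss_fun_ge0// mulr_ge0// (le_trans x0).
  - by rewrite lee_fin exprn_ge0.
  by rewrite tail_gauss// -EFinM mulr1.
rewrite fubini_tonelli// /half_moment -integral_indicE -ge0_integralZl//; last first.
- move=> x _; rewrite lee_fin posE; have [x0|_] := leP 0 x; last by rewrite mulr0.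
  by rewrite mulr1 mulr_ge0 ?exprn_ge0 ?gauss_fun_ge0.
apply: eq_integral => r _; rewrite -EFinM.
transitivity (\int[mu]_(x in `[0%R, r]) ((2 * r * gauss_fun r)%:E * (x ^+ k)%:E))%E.
  rewrite -[RHS]integral_indicE; apply: eq_integral => x _; rewrite /Xi/=.
  rewrite !posE indicE; have -> : (x \in `[0%R, r]%classic) = ((0 <= x) && (0 <= r - x)).
    by apply/idP/idP; rewrite !inE/= !in_itv/= subr_ge0.
  by rewrite -mulnb natrM; congr _%:E; ring.
have [r0|r0] := leP 0 r; last first.
  rewrite set_itv_ge ?bnd_simp -?ltNge// integral_set0.
  by rewrite -/pos posE leNgt r0 !mulr0.
rewrite ge0_integralZl//; last 3 first.
- by apply/measurable_EFinP; apply: measurable_funTS; exact: measurable_funX.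
- by move=> x; rewrite /= in_itv/= => /andP[x0 _]; rewrite lee_fin exprn_ge0.
- by rewrite lee_fin mulr_ge0 ?gauss_fun_ge0// mulr_ge0.
rewrite integral_pow// -EFinM -/pos posE r0.
congr _%:E; rewrite mulr1 !exprS; field.
by rewrite nat1r pnatr_eq0.
Qed.

Lemma even_integral_half j :
  (\int[mu]_x (x ^+ j.*2 * gauss_fun x)%:E = 2%:E * half_moment j.*2)%E.
Proof.
rewrite (@ge0_symfun_integralT R (fun x => x ^+ j.*2 * gauss_fun x)).
- by rewrite /half_moment -set_itvcy.
- by move=> x; rewrite mulr_ge0 ?gauss_fun_ge0// -mul2n exprM exprn_ge0// sqr_ge0.
- move=> x; apply: cvgM; [exact: exprn_continuous|exact: continuous_gauss_fun].
- by move=> x /=; rewrite /gauss_fun -mul2n !exprM sqrrN.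
Qed.

(** The powers of 2 come from the density exp(-x^2), of variance 1/2. *)
Lemma gauss_even_moment j :
  (\int[mu]_x (x ^+ j.*2 * gauss_fun x)%:E =
   ((gauss_moment j.*2)%:R / 2 ^+ j * Num.sqrt pi)%:E)%E.
Proof.
elim: j => [|j IHj].
  rewrite expr0 divr1 mul1r -integralT_gauss.
  by apply: eq_integral => x _; rewrite expr0 mul1r.
have k0 : j.*2.+1%:R != 0 :> R by rewrite pnatr_eq0.
have : ((2 / j.*2.+1%:R)%:E * \int[mu]_x (x ^+ j.+1.*2 * gauss_fun x)%:E =
    \int[mu]_x (x ^+ j.*2 * gauss_fun x)%:E)%E.
  by rewrite !even_integral_half muleCA -half_momentSS.
rewrite IHj => /(congr1 (fun z => (j.*2.+1%:R / 2)%:E * z)%E).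
rewrite muleA -!EFinM (_ : _ / 2 * _ = 1); last by field.
rewrite mul1e => ->; congr _%:E.
rewrite doubleS [gauss_moment _.+2]/= natrM exprS; field.
by rewrite expf_neq0// pnatr_eq0.
Qed.
End gauss_moments.

(** * Moments of the sphere *)

Section sphere_moments.
Context (R : realType).
Local Notation mR := (measurableTypeR R).
Local Notation mu := (@lebesgue_measure R).

Definition monomial d (a : 'I_d -> nat) (x : d.-tuple R) : R :=
  \prod_(i < d) tnth x i ^+ a i.

Lemma measurable_monomial d (a : 'I_d -> nat) :
  measurable_fun [set: d.-tuple mR] (monomial a : d.-tuple mR -> R).
Proof.
apply: measurable_prod => i _; apply: measurable_funX; exact: measurable_tnth.
Qed.

Lemma radial_projE d (x : d.-tuple mR) : radial_proj x = tscale (fun=> (enorm x)^-1) x.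
Proof. by []. Qed.

Lemma monomial_scale d (a : 'I_d -> nat) (c : R) (x : d.-tuple mR) :
  monomial a (tscale (fun=> c) x) = c ^+ (\sum_i a i) * monomial a x.
Proof.
rewrite /monomial expr_sum -big_split; apply: eq_bigr => i _.
by rewrite tnth_mktuple exprMn.
Qed.

Lemma enorm_radial_proj d (x : d.-tuple mR) : enorm x != 0 -> enorm (radial_proj x) = 1.
Proof. by move=> x0; rewrite radial_projE enorm_tscale ?invr_ge0 ?enorm_ge0// mulVf. Qed.

Lemma enorm_eq0 d (x : d.-tuple mR) i : enorm x = 0 -> tnth x i = 0.
Proof.
move/eqP; rewrite /enorm sqrtr_eq0 => s0.
have s_ge0 : 0 <= \sum_(i < d) tnth x i ^+ 2 by rewrite sumr_ge0// => j _; rewrite sqr_ge0.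
have /(psumr_eq0P (fun i _ => sqr_ge0 (tnth x i)))/(_ i isT)/eqP :
  \sum_(i < d) tnth x i ^+ 2 = 0 by apply/le_anti; rewrite s0 s_ge0.
by rewrite sqrf_eq0 => /eqP.
Qed.

Lemma le_coord_enorm d (x : d.-tuple mR) i : `|tnth x i| <= enorm x.
Proof.
rewrite -sqrtr_sqr /enorm ler_wsqrtr// (bigD1 i)//= lerDl sumr_ge0// => j _.
exact: sqr_ge0.
Qed.

Lemma monomial_le1 d (a : 'I_d -> nat) (x : d.-tuple mR) : enorm x <= 1 -> `|monomial a x| <= 1.
Proof.
move=> x1; rewrite /monomial normr_prod; apply: prodr_ile1 => i _.
by rewrite normr_ge0 normrX exprn_ile1// (le_trans (le_coord_enorm _ _)).
Qed.

(** The sphere measure is the image of the uniform measure on the ball under radial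
    projection; the origin projects off the sphere, hence the last hypothesis. *)
Lemma ge0_integral_sphere d (F : d.-tuple mR -> R) :
  measurable_fun setT F -> (forall x, 0 <= F x) ->
  (forall x, enorm x = 0 -> F (radial_proj x) = 0) ->
  (\int[@sphere_measure R d]_(x in unit_sphere) (F x)%:E =
   (fine (lebesgue_tuple R d unit_ball))^-1%:E *
   \int[lebesgue_tuple R d]_x (F (radial_proj x) * \1_(@unit_ball R d) x)%:E)%E.
Proof.
move=> mF F0 Fz.
have k0 : 0 <= (fine (lebesgue_tuple R d unit_ball))^-1 by rewrite invr_ge0 fine_ge0.
have mB := @measurable_unit_ball R d; have mP := @measurable_radial_proj R d.
have mS := @measurable_unit_sphere R d.
pose bm : {measure set (d.-tuple mR) -> \bar R} := mrestr (lebesgue_tuple R d) mB.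
pose pm : {measure set (d.-tuple mR) -> \bar R} :=
  measure_function_pushforward__canonical__measure_function_Measure bm mP.
have mPS : measurable (@radial_proj R d @^-1` unit_sphere).
  by rewrite -[X in measurable X]setTI; exact: (@measurable_radial_proj R d).
have mFP : measurable_fun setT (fun x => (F (radial_proj x))%:E).
  by apply/measurable_EFinP; exact: measurableT_comp.
transitivity (\int[mscale (NngNum k0) pm]_(x in unit_sphere) (F x)%:E)%E.
  by apply: eq_measure_integral.
rewrite ge0_integral_mscale//; last 2 first.
- by apply/measurable_EFinP; exact: measurable_funTS.
- by move=> x _; rewrite lee_fin.
congr (_ * _)%E.
rewrite ge0_integral_pushforward//; last 2 first.
- by apply/measurable_EFinP; exact: measurable_funTS.
- by move=> x _; rewrite lee_fin.
rewrite (@ge0_negligible_integral _ _ _ bm _ (~` unit_ball))//=; last 4 first.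
- exact: measurableC.
- exact: measurable_funTS.
- by move=> x _; rewrite lee_fin.
- by rewrite /bm /mrestr setICl measure0.
rewrite setDE setCK.
transitivity (\int[lebesgue_tuple R d]_(x in @radial_proj R d @^-1` unit_sphere `&` unit_ball)
    (F (radial_proj x))%:E)%E.
  apply: eq_measure_integral => A mA AS; rewrite /bm /= /mrestr.
  by rewrite setIidl// => x /AS[].
rewrite integral_mkcond; apply: eq_integral => x _; rewrite patchE indicE.
have [x0|x0] := eqVneq (enorm x) 0.
  by rewrite Fz// mul0r; case: ifP.
have -> : (x \in @radial_proj R d @^-1` unit_sphere `&` unit_ball) = (x \in @unit_ball R d).
  apply/idP/idP; rewrite !inE; first by case.
  by move=> xB; split => //; exact: enorm_radial_proj.
by case: ifP; rewrite ?mulr1 ?mulr0.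
Qed.

Lemma integral_shell n : (\int[mu]_s (shell n s)%:E = (n.+1%:R^-1)%:E :> \bar R)%E.
Proof.
rewrite (integral_indicE (`]0, 1]%classic : set mR) (fun s => s ^+ n)).
rewrite integral_itv_obnd_cbnd; last first.
  by apply/measurable_EFinP; apply: measurable_funTS; exact: measurable_funX.
by rewrite integral_pow// expr1n div1r.
Qed.

Lemma gauss_moment_even_gt0 j : (0 < gauss_moment j.*2)%N.
Proof. by elim: j => // j IHj; rewrite doubleS/= muln_gt0. Qed.

Lemma even_sum (I : finType) (a : I -> nat) :
  (forall i, ~~ odd (a i)) -> ~~ odd (\sum_i a i).
Proof.
by move=> ae; elim/big_ind: _ => // x y xe ye; rewrite oddD (negPf xe).
Qed.

(** The density exp(-|x|^2) is a product over the coordinates.  The constant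
    depends on the exponents only through their sum s. *)
Lemma integral_gauss_monomial d (a : 'I_d -> nat) s : (forall i, ~~ odd (a i)) ->
  (\sum_i a i = s)%N ->
  (\int[lebesgue_tuple R d]_x (monomial a x * gauss_fun (enorm x))%:E =
   (Num.sqrt pi ^+ d / 2 ^+ s./2 * \prod_i (gauss_moment (a i))%:R)%:E :> \bar R)%E.
Proof.
move=> aeven as_; have aE i : a i = (a i)./2.*2 by rewrite even_halfK.
transitivity (\int[lebesgue_tuple R d]_x
    (\prod_(i < d) (tnth x i ^+ a i * gauss_fun (tnth x i)))%:E)%E.
  apply: eq_integral => x _; rewrite big_split/=; congr (_ * _)%:E.
  rewrite /gauss_fun /enorm sqr_sqrtr; last by rewrite sumr_ge0// => i _; exact: sqr_ge0.
  by rewrite -sumrN expR_sum.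
rewrite (@ge0_integral_lebesgue_tuple_prod R d (fun i y => y ^+ a i * gauss_fun y)).
- have E i : (\int[mu]_y (y ^+ a i * gauss_fun y)%:E =
      (Num.sqrt pi * ((2 ^+ (a i)./2)^-1 * (gauss_moment (a i))%:R))%:E)%E.
    by rewrite (aE i) gauss_even_moment doubleK mulrC [in X in _ * X]mulrC.
  rewrite (eq_bigr _ (fun i _ => E i)).
  rewrite -(@big_morph _ _ EFin 1%E *%E 1 *%R)//; congr _%:E.
  have -> : (s./2 = \sum_i (a i)./2)%N.
    apply: double_inj; rewrite -as_ even_halfK.
      rewrite -mul2n big_distrr/=; apply: eq_bigr => i _.
      by rewrite mul2n -aE.
    exact: even_sum.
  by rewrite expr_sum !big_split/= prodr_const card_ord prodfV mulrA.
- by move=> i; apply: measurable_funM; [exact: measurable_funX|exact: measurable_gauss_fun].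
- by move=> i y; rewrite mulr_ge0 ?gauss_fun_ge0// aE -mul2n exprM exprn_ge0// sqr_ge0.
Qed.

Lemma mule_EFin_gt0 (u v : \bar R) (p : R) : (0 <= u)%E -> (0 <= v)%E -> 0 < p ->
  (u * v = p%:E)%E -> exists2 q, v = q%:E & 0 < q.
Proof.
move=> u0; case: v => [q||]//.
  rewrite lee_fin le_eqVlt => /predU1P[<-|q0]; last by exists q.
  by move=> p0; rewrite mule0 => -[pE]; rewrite -pE ltxx in p0.
move: u0; rewrite le_eqVlt => /predU1P[<-|ugt] _ p0.
  by rewrite mul0e => -[pE]; rewrite -pE ltxx in p0.
by rewrite gt0_muley.
Qed.

(** Compare the integrals over the ball and against the Gaussian density by
    [ge0_integral_radial], with the profile r^s exp(-r^2).  The monomial x_0^s has a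
    positive finite Gaussian integral, which shows that the constant of that lemma
    is positive and finite. *)
Lemma sphere_even_moments n s : (0 < s)%N -> exists c : R,
  forall a : 'I_n.+1 -> nat, (\sum_i a i = s)%N -> (forall i, ~~ odd (a i)) ->
  (\int[@sphere_measure R n.+1]_(x in unit_sphere) (monomial a x)%:E =
   (c * \prod_i (gauss_moment (a i))%:R)%:E)%E.
Proof.
move=> s0; have [os|es] := boolP (odd s).
  by exists 0 => a as_ /even_sum; rewrite as_ os.
pose g (r : mR) : R := r ^+ s * gauss_fun r.
pose J (a : 'I_n.+1 -> nat) : \bar R := (\int[lebesgue_tuple R n.+1]_x
  (monomial a (radial_proj x) * \1_(@unit_ball R n.+1) x)%:E)%E.
pose gam : \bar R := (\int[mu]_r (inverted_radial n g r 1)%:E)%E.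
pose K : R := Num.sqrt pi ^+ n.+1 / 2 ^+ s./2 / n.+1%:R.
have K0 : 0 < K by rewrite !divr_gt0 ?exprn_gt0 ?sqrtr_gt0 ?pi_gt0 ?ltr0n.
pose good (a : 'I_n.+1 -> nat) := (\sum_i a i = s)%N /\ (forall i, ~~ odd (a i)).
have mon_ge0 a (x : n.+1.-tuple mR) : good a -> 0 <= monomial a x.
  case=> _ aeven; apply: prodr_ge0 => i _.
  by rewrite -(even_halfK (aeven i)) -mul2n exprM exprn_ge0// sqr_ge0.
have mon_z a (x : n.+1.-tuple mR) : good a -> enorm x = 0 -> monomial a (radial_proj x) = 0.
  by case=> as_ _ x0; rewrite radial_projE monomial_scale as_ x0 invr0 expr0n gtn_eqF// mul0r.
have mmonP a : measurable_fun setT (fun x : n.+1.-tuple mR => monomial a (radial_proj x)).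
  by apply: measurableT_comp; [exact: measurable_monomial|exact: measurable_radial_proj].
have JE a : good a -> (J a * gam = (K * \prod_i (gauss_moment (a i))%:R)%:E)%E.
  move=> ga;
    rewrite -(@ge0_integral_radial R n g (fun x => monomial a (radial_proj x)))//; last 5 first.
  - by apply: measurable_funM; [exact: measurable_funX|exact: measurable_gauss_fun].
  - move=> r; rewrite mulr_ge0 ?gauss_fun_ge0// -(even_halfK es) -mul2n exprM.
    by rewrite exprn_ge0// sqr_ge0.
  - by move=> x; exact: mon_ge0.
  - move=> r x r0; congr monomial; rewrite !radial_projE enorm_tscale ?ltW//.
    apply: eq_from_tnth => i; rewrite !tnth_mktuple invfM mulrACA.
    by rewrite mulVf ?gt_eqF// mul1r.
  - by move=> x; exact: mon_z.
  have -> : (\int[lebesgue_tuple R n.+1]_x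
      (monomial a (radial_proj x) * g (enorm x))%:E =
      \int[lebesgue_tuple R n.+1]_x (monomial a x * gauss_fun (enorm x))%:E)%E.
    apply: eq_integral => x _; congr _%:E.
    have [x0|x0] := eqVneq (enorm x) 0.
      rewrite mon_z// mul0r (_ : monomial a x = 0) ?mul0r// /monomial.
      under eq_bigr do rewrite (enorm_eq0 _ x0).
      by rewrite -expr_sum; case: ga => -> _; rewrite expr0n gtn_eqF.
    rewrite radial_projE monomial_scale /g; case: ga => -> _.
    by rewrite exprVn; field; rewrite expf_neq0.
  case: ga => as_ aeven; rewrite (integral_gauss_monomial aeven as_) integral_shell -EFinM.
  by rewrite /K; congr _%:E; ring.
have J0 a : good a -> (0 <= J a)%E.
  by move=> ga; apply: integral_ge0 => x _; rewrite lee_fin mulr_ge0// mon_ge0.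
have gam0 : (0 <= gam)%E.
  apply: integral_ge0 => r _; rewrite lee_fin; apply: inverted_radial_ge0 => u.
  rewrite mulr_ge0 ?gauss_fun_ge0// -(even_halfK es) -mul2n exprM.
  by rewrite exprn_ge0// sqr_ge0.
have prod0 a : good a -> 0 < K * \prod_i (gauss_moment (a i))%:R.
  case=> _ aeven; rewrite mulr_gt0// prodr_gt0// => i _.
  by rewrite ltr0n -(even_halfK (aeven i)) gauss_moment_even_gt0.
pose a0 (i : 'I_n.+1) := if i == ord0 then s else 0%N.
have ga0 : good a0.
  split=> [|i]; last by rewrite /a0; case: ifP.
  by rewrite (bigD1 ord0)//= big1 ?addn0// => i /negPf; rewrite /a0 => ->.
have [q gamE q0] : exists2 q : R, gam = q%:E & 0 < q.
  exact: mule_EFin_gt0 (J0 _ ga0) gam0 (prod0 _ ga0) (JE _ ga0).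
exists ((fine (lebesgue_tuple R n.+1 unit_ball))^-1 * (K / q)) => a as_ aeven.
have ga : good a by [].
rewrite ge0_integral_sphere//; last 3 first.
- exact: measurable_monomial.
- by move=> x; exact: mon_ge0.
- by move=> x; exact: mon_z.
rewrite -/(J a) -mulrA EFinM; congr (_ * _)%E.
have := JE _ ga; rewrite gamE; have := J0 _ ga; case: (J a) => [j||]//; last by rewrite gt0_mulye.
move=> _ [jE]; congr _%:E; apply: (mulIf (lt0r_neq0 q0)); rewrite jE.
by field; exact: lt0r_neq0.
Qed.
End sphere_moments.

Section odd_moments.
Context (R : realType).
Local Notation mR := (measurableTypeR R).

Lemma integrable_monomial d (a : 'I_d -> nat) :
  (@sphere_measure R d).-integrable unit_sphere (EFin \o (monomial a : d.-tuple mR -> R)).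
Proof.
have mS := @measurable_unit_sphere R d.
apply: measurable_bounded_integrable => //.
- apply: (@le_lt_trans _ _ (@sphere_measure R d setT)).
    by apply: le_measure; rewrite ?inE.
  by rewrite sphere_measure_setT ltry.
- by apply: measurable_funTS; exact: measurable_monomial.
- exists 1; split; first exact: num_real.
  move=> M M1 x Sx /=; rewrite (le_trans _ (ltW M1))// monomial_le1//.
  by rewrite Sx.
Qed.

Lemma enorm_flip d (c : 'I_d -> R) (x : d.-tuple mR) :
  (forall i, `|c i| = 1) -> enorm (tscale c x) = enorm x.
Proof.
move=> c1; congr Num.sqrt; apply: eq_bigr => i _.
by rewrite tnth_mktuple exprMn -real_normK ?num_real// c1 expr1n mul1r.
Qed.

Lemma sphere_measure_flip d (c : 'I_d -> R) (A : set (d.-tuple mR)) :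
  (forall i, `|c i| = 1) -> measurable A ->
  sphere_measure (tscale c @^-1` A) = sphere_measure A.
Proof.
move=> c1 mA; have cE (x : d.-tuple mR) := enorm_flip x c1.
have cP (x : d.-tuple mR) : radial_proj (tscale c x) = tscale c (radial_proj x).
  by apply: eq_from_tnth => i; rewrite !tnth_mktuple cE mulrCA.
have mP : measurable (@radial_proj R d @^-1` A).
  by rewrite -[X in measurable X]setTI; exact: (@measurable_radial_proj R d).
have mB := @measurable_unit_ball R d.
rewrite /sphere_measure; congr (_ * _)%E.
have -> : @radial_proj R d @^-1` (tscale c @^-1` A) `&` unit_ball =
    tscale c @^-1` (@radial_proj R d @^-1` A `&` unit_ball).
  by apply/seteqP; split => x; rewrite /unit_ball/= cP cE.
have mAB : measurable (@radial_proj R d @^-1` A `&` unit_ball) by exact: measurableI.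
have indicI (B : set (d.-tuple mR)) : measurable B ->
    lebesgue_tuple R d B = (\int[lebesgue_tuple R d]_x (\1_B x)%:E)%E.
  by move=> mB'; rewrite integral_indic// setIT.
rewrite !indicI//; last first.
  by rewrite -[X in measurable X]setTI; exact: measurable_tscale.
rewrite [RHS](@ge0_integral_tscale R d c)//.
- rewrite big1 => [|i _]; last exact: c1.
  by rewrite mul1e.
- by move=> i; rewrite -normr_eq0 c1 oner_eq0.
- by apply/measurable_EFinP; exact: measurable_indic.
Qed.

(** Reflecting the coordinate i changes the sign of the monomial and preserves the
    measure. *)
Lemma sphere_odd_moments d (a : 'I_d -> nat) i : odd (a i) ->
  (\int[@sphere_measure R d]_(x in unit_sphere) (monomial a x)%:E = 0 :> \bar R)%E.
Proof.
move=> oai; pose c j : R := if j == i then -1 else 1.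
have c1 j : `|c j| = 1 by rewrite /c; case: ifP; rewrite ?normrN normr1.
have mc := @measurable_tscale R d c.
pose I := (\int[@sphere_measure R d]_(x in unit_sphere) (monomial a x)%:E)%E.
have Ifin : I \is a fin_num.
  by apply: integrable_fin_num; [exact: measurable_unit_sphere|exact: integrable_monomial].
have cS : tscale c @^-1` unit_sphere = unit_sphere.
  by apply/seteqP; split => x; rewrite /unit_sphere/= enorm_flip.
have : I = (- I)%E.
  rewrite {1}/I -[RHS]oppeK oppeK.
  transitivity (\int[pushforward (@sphere_measure R d) (tscale c)]_(x in unit_sphere)
    (monomial a x)%:E)%E.
    apply: eq_measure_integral => //.
    move=> A mA _; exact: (esym (sphere_measure_flip c1 mA)).
  have fc (x : d.-tuple mR) : monomial a (tscale c x) = - monomial a x.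
    rewrite /monomial (bigD1 i)//= [in RHS](bigD1 i)//= tnth_mktuple /c eqxx exprMn -mulrA.
    rewrite -signr_odd oai expr1 mulN1r; congr (- (_ * _)).
    by apply: eq_bigr => j /negPf ji; rewrite tnth_mktuple ji mul1r.
  rewrite integral_pushforward//.
  - rewrite cS; under eq_integral do rewrite /= fc EFinN.
    rewrite integralN//.
    by apply: integrable_add_def; [exact: measurable_unit_sphere|exact: integrable_monomial].
  - by apply/measurable_EFinP; exact: measurable_monomial.
  - rewrite cS.
    rewrite (_ : _ \o _ = (fun x => - (monomial a x)%:E)%E); last first.
      by apply/funext => x /=; rewrite fc EFinN.
    exact: integrableN (integrable_monomial a).
  - exact: measurable_unit_sphere.
move: Ifin; rewrite -/I; case: I => // r _ [] /eqP; rewrite -subr_eq0 opprK -mulr2n.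
by rewrite mulrn_eq0/= => /eqP->.
Qed.
End odd_moments.

Section sphere_linear.
Context (R : realType).
Local Notation mR := (measurableTypeR R).

Definition sphere_moment d (a : 'I_d -> nat) : R :=
  fine (\int[@sphere_measure R d]_(x in unit_sphere) (monomial a x)%:E)%E.

Lemma integral_sphere_lincomb d (I : Type) (r : seq I) (w : I -> R) (a : I -> 'I_d -> nat) :
  (\int[@sphere_measure R d]_(x in unit_sphere) (\sum_(i <- r) w i * monomial (a i) x)%:E =
   (\sum_(i <- r) w i * sphere_moment (a i))%:E)%E.
Proof.
have mS := @measurable_unit_sphere R d.
under eq_integral do rewrite -sumEFin.
rewrite (@integral_sum _ _ _ (@sphere_measure R d) unit_sphere mS _
  (fun i x => (w i * monomial (a i) x)%:E)); last first.
  by move=> i; exact: (integrableZl mS (w i) (integrable_monomial R (a i))).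
rewrite -sumEFin; apply: eq_bigr => i _; under eq_integral do rewrite EFinM.
rewrite integralZl//; last exact: integrable_monomial.
rewrite EFinM fineK//; apply: integrable_fin_num; [exact: mS|exact: integrable_monomial].
Qed.

Lemma gauss_moment_odd k : odd k -> gauss_moment k = 0%N.
Proof.
have [m] := ubnP k; elim: m k => // m IHm [|[|k]]//=.
by rewrite ltnS negbK => km ok; rewrite IHm ?muln0// ltnW.
Qed.

Lemma sphere_moment_odd d (a : 'I_d -> nat) i : odd (a i) -> sphere_moment a = 0.
Proof. by move=> ai; rewrite /sphere_moment (sphere_odd_moments _ ai). Qed.

Lemma sphere_moment0 n (a : 'I_n.+1 -> nat) : (forall i, a i = 0%N) -> sphere_moment a = 1.
Proof.
move=> a0; rewrite /sphere_moment (_ : (\int[_]_(x in _) _)%E = 1%E)//.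
rewrite -(@sphere_measure_unit_sphere R n.+1)// -[RHS]mul1e -integral_cst; last first.
  exact: measurable_unit_sphere.
apply: eq_integral => x _; rewrite /monomial big1// => i _.
by rewrite a0 expr0.
Qed.

(** The constant is the same for all monomials of degree s.  An odd exponent makes
    both sides vanish. *)
Lemma sphere_moment_gauss n s : exists c, forall a : 'I_n.+1 -> nat, (\sum_i a i = s)%N ->
  sphere_moment a = c * \prod_i (gauss_moment (a i))%:R.
Proof.
have [->|s0] := posnP s.
  exists 1 => a a0; have {}a0 i : a i = 0%N.
    by move/eqP: a0; rewrite sum_nat_eq0 => /forallP/(_ i)/eqP.
  by rewrite sphere_moment0// mul1r big1 => // i _; rewrite a0.
have [c cE] := @sphere_even_moments R n s s0; exists c => a as_.
have [/forallP ae|] := boolP [forall i, ~~ odd (a i)]; first by rewrite /sphere_moment cE.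
rewrite negb_forall => /existsP[i]; rewrite negbK => oi.
by rewrite (sphere_moment_odd oi) (bigD1 i)//= gauss_moment_odd// mul0r mulr0.
Qed.
End sphere_linear.

Section expand.
Context (R : realType) (d : nat).

(** The exponents of the product of the monomial a and the squares of the
    coordinates k_0, ..., k_(j-1). *)
Definition raise_squares j (a : 'I_d -> nat) (k : {ffun 'I_j -> 'I_d}) (i : 'I_d) : nat :=
  (a i + \sum_(l < j) (k l == i).*2)%N.

Lemma sum_raise j (a : 'I_d -> nat) k : (\sum_i @raise_squares j a k i = \sum_i a i + j.*2)%N.
Proof.
rewrite big_split/=; congr addn; rewrite exchange_big/=.
rewrite (eq_bigr (fun=> 2%N)) ?sum_nat_const ?card_ord ?muln2// => l _.
rewrite (bigD1 (k l))//= eqxx big1// => i /negPf ik.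
by rewrite eq_sym ik.
Qed.

Lemma monomial_raise j (a : 'I_d -> nat) (x : d.-tuple R) :
  monomial a x * (\sum_i tnth x i ^+ 2) ^+ j = \sum_k monomial (@raise_squares j a k) x.
Proof.
rewrite -[j in LHS]card_ord -prodr_const bigA_distr_bigA mulr_sumr/=.
apply: eq_bigr => k _; rewrite /monomial; under [RHS]eq_bigr do rewrite exprD.
rewrite [RHS]big_split/=; congr (_ * _); under [RHS]eq_bigr do rewrite expr_sum.
rewrite exchange_big/=; apply: eq_bigr => l _.
rewrite (bigD1 (k l))//= eqxx big1 ?mulr1// => i /negPf ik.
by rewrite eq_sym ik.
Qed.
End expand.

(** On the sphere |x|^2 = 1, so degrees can be raised by even numbers. *)
Lemma sphere_moment_raise (R : realType) d j (a : 'I_d -> nat) :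
  sphere_moment R a = \sum_(k : {ffun 'I_j -> 'I_d}) sphere_moment R (raise_squares a k).
Proof.
apply: EFin_inj.
rewrite -[in RHS](eq_bigr _ (fun k _ => mul1r (sphere_moment R (raise_squares a k)))).
rewrite -(integral_sphere_lincomb _ (fun=> 1)) /sphere_moment fineK; last first.
  by apply: integrable_fin_num; [exact: measurable_unit_sphere|exact: integrable_monomial].
apply: eq_integral => x; rewrite inE => x1; congr _%:E.
have <- : monomial a x * (\sum_i tnth x i ^+ 2) ^+ j = monomial a x.
  move/(congr1 (fun z => z ^+ 2)): x1; rewrite expr1n sqr_sqrtr => [->|].
    by rewrite expr1n mulr1.
  by rewrite sumr_ge0// => i _; exact: sqr_ge0.
by rewrite monomial_raise; apply: eq_bigr => k _; rewrite mul1r.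
Qed.

(** * Spherical designs from integer points *)

Section design_of_integer_points.
Local Open Scope mset_scope.
Context (R : realType) (n k : nat) (U : finType) (X : U -> 'I_n.+1 -> int) (K : R).

Definition int_point u : n.+1.-tuple R := [tuple (X u i)%:~R | i < n.+1].

(** |X|^(2k), which is a natural number because X has integer coordinates. *)
Definition multiplicity u : nat := ((\sum_i `|X u i| ^ 2) ^ k)%N.

Definition antipodal_point (b : bool) u : n.+1.-tuple R :=
  tscale (fun=> (-1) ^+ b) (radial_proj (int_point u)).

Definition design_seq : seq (n.+1.-tuple R) :=
  flatten [seq nseq (multiplicity u) (antipodal_point false u) ++
               nseq (multiplicity u) (antipodal_point true u) | u <- enum U].

Lemma multiplicityE u :
  (multiplicity u)%:R = (\sum_i tnth (int_point u) i ^+ 2) ^+ k :> R.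
Proof.
rewrite /multiplicity natrX natr_sum; congr (_ ^+ k); apply: eq_bigr => i _.
by rewrite natrX natr_absz tnth_mktuple intr_norm real_normK ?num_real.
Qed.

Lemma sum_design_seq (f : n.+1.-tuple R -> R) :
  \sum_(x <- design_seq) f x =
  \sum_u (multiplicity u)%:R * (f (antipodal_point false u) + f (antipodal_point true u)).
Proof.
rewrite big_flatten big_map big_enum; apply: eq_bigr => u _.
by rewrite big_cat/= !big_nseq -!Monoid.iteropE/= -mulrnDl mulr_natl.
Qed.

Context (nonzero : forall u, (0 < k)%N || (enorm (int_point u) != 0)) (K0 : K != 0)
  (moments : forall a : 'I_n.+1 -> nat, (\sum_i a i = k.*2)%N ->
    \sum_u monomial a (int_point u) = K * \prod_i (gauss_moment (a i))%:R).

(** Since |X|^(2k) a(X / |X|) = |X|^(2j) a(X) for a monomial a of degree 2k - 2j,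
    expanding |X|^(2j) reduces the sum to moments of degree exactly 2k. *)
Lemma sum_projected j (a : 'I_n.+1 -> nat) : (\sum_i a i + j.*2 = k.*2)%N ->
  \sum_u (multiplicity u)%:R * monomial a (radial_proj (int_point u)) =
  K * \sum_(l : {ffun 'I_j -> 'I_n.+1}) \prod_i (gauss_moment (raise_squares a l i))%:R.
Proof.
move=> as_; rewrite mulr_sumr.
transitivity (\sum_l \sum_u monomial (@raise_squares _ j a l) (int_point u)); last first.
  by apply: eq_bigr => l _; rewrite moments// sum_raise.
rewrite exchange_big; apply: eq_bigr => u _ /=; rewrite -monomial_raise multiplicityE.
set x := int_point u.
have sE : \sum_i tnth x i ^+ 2 = enorm x ^+ 2.
  by rewrite sqr_sqrtr// sumr_ge0// => i _; exact: sqr_ge0.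
rewrite sE -!exprM ![(2 * _)%N]mul2n -as_.
have [x0|x0] := eqVneq (enorm x) 0.
  have := nonzero u; rewrite -/x x0 eqxx orbF => k0.
  rewrite expr0n as_ double_eq0 gtn_eqF// mul0r.
  have [j0|j0] := posnP j; last by rewrite expr0n double_eq0 gtn_eqF// mulr0.
  rewrite /monomial (eq_bigr (fun i => 0 ^+ a i)).
    by move: as_; rewrite j0 addn0 -expr_sum => ->; rewrite expr0n double_eq0 gtn_eqF// mul0r.
  by move=> i _; rewrite (enorm_eq0 _ x0).
rewrite radial_projE monomial_scale exprD mulrCA mulrA mulrA exprVn.
by rewrite mulVf ?expf_neq0// mul1r mulrC.
Qed.

Lemma monomial_antipodal b u (a : 'I_n.+1 -> nat) :
  monomial a (antipodal_point b u) =
  (-1) ^+ (b * \sum_i a i) * monomial a (radial_proj (int_point u)).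
Proof. by rewrite monomial_scale -exprM. Qed.

(** The sums over the design and the moments of the sphere are proportional in
    degree 2k, and the constant monomial, raised to degree 2k, identifies the ratio. *)
Lemma design_seq_monomial (a : 'I_n.+1 -> nat) : (\sum_i a i <= k.*2.+1)%N ->
  (size design_seq)%:R^-1 * \sum_(x <- design_seq) monomial a x = sphere_moment R a.
Proof.
move=> ak; rewrite sum_design_seq.
have [oa|ea] := boolP (odd (\sum_i a i)).
  rewrite big1 ?mulr0 => [|u _].
    have [i oi] : exists i, odd (a i).
      by apply/existsP; apply: contraLR oa => /existsPn/even_sum.
    by rewrite (sphere_moment_odd _ oi).
  rewrite !monomial_antipodal mul0n mul1n -(signr_odd _ (\sum_i a i)%N) oa.
  by rewrite expr0 expr1 mul1r mulN1r subrr mulr0.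
have [c cE] := sphere_moment_gauss R n k.*2.
pose z (i : 'I_n.+1) := 0%N; pose Z : R :=
  \sum_(l : {ffun 'I_k -> 'I_n.+1}) \prod_i (gauss_moment (raise_squares z l i))%:R.
have z0 : (\sum_i z i = 0)%N by rewrite big1.
have cZ : c * Z = 1.
  rewrite -(@sphere_moment0 R n z)// (sphere_moment_raise R k) mulr_sumr.
  by apply: eq_bigr => l _; rewrite cE// sum_raise z0.
have sizeE : (size design_seq)%:R = 2 * (K * Z).
  rewrite -(sum_projected (j := k) (a := z)) ?z0//.
  rewrite -sum1_size natr_sum (sum_design_seq (fun=> 1)) mulr_sumr; apply: eq_bigr => u _.
  by rewrite /monomial big1// mulr1 mulrC.
have [j jE] : exists j, (\sum_i a i + j.*2 = k.*2)%N.
  exists (k - (\sum_i a i)./2)%N; rewrite doubleB even_halfK// subnKC//.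
  move: ak; rewrite leq_eqVlt ltnS => /predU1P[aE|//].
  by move: ea; rewrite aE /= odd_double.
rewrite (sphere_moment_raise R j).
rewrite (eq_bigr (fun l => c * \prod_i (gauss_moment (raise_squares a l i))%:R)); last first.
  by move=> l _; rewrite cE// sum_raise.
rewrite -mulr_sumr.
rewrite (eq_bigr (fun u => (multiplicity u)%:R * monomial a (radial_proj (int_point u)) * 2)).
  rewrite -mulr_suml (sum_projected jE) sizeE.
  have Z0 : Z != 0 by apply: contra_eq_neq cZ => ->; rewrite mulr0 eq_sym oner_eq0.
  have -> : c = Z^-1 by rewrite -[c](mulfK Z0) cZ mul1r.
  by field; rewrite Z0 K0.
move=> u _; rewrite !monomial_antipodal mul0n mul1n -(signr_odd _ (\sum_i a i)%N).
by rewrite (negPf ea) !expr0 mul1r; ring.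
Qed.

Lemma design_of_integer_points :
  unweighted_spherical_design k.*2.+1 (seq_mset design_seq) /\
  (#|` finsupp (seq_mset design_seq)| <= 2 * #|U|)%N.
Proof.
have memE x : (x \in seq_mset design_seq) = (x \in design_seq).
  exact: perm_mem (perm_eq_seq_mset design_seq) x.
have mem_design x : x \in design_seq ->
    exists b u, x = antipodal_point b u /\ (0 < multiplicity u)%N.
  case/flatten_mapP => u _; rewrite mem_cat !mem_nseq => /orP[]/andP[m0 /eqP->].
    by exists false, u.
  by exists true, u.
split; [split=> [x|p psize]|].
- rewrite memE => /mem_design[b [u [-> m0]]]; rewrite /unit_sphere/= enorm_flip.
    apply: enorm_radial_proj; have := nonzero u; case: posnP => //= k0 _.
    apply: contraTneq m0 => x0; rewrite -(ltr_nat R) multiplicityE.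
    rewrite big1 ?expr0n ?gtn_eqF ?ltxx// => i _.
    by rewrite (enorm_eq0 _ x0) expr0n.
  by move=> _; rewrite normrX normrN1 expr1n.
- rewrite (perm_size (perm_eq_seq_mset _)) (perm_big _ (perm_eq_seq_mset _))/=.
  rewrite [RHS](integral_sphere_lincomb (mpoly.msupp p) (fun m => mpoly.mcoeff m p)
    (fun m i => m i)).
  congr _%:E; rewrite exchange_big/= mulr_sumr big_seq [RHS]big_seq.
  apply: eq_bigr => m mp; rewrite -mulr_sumr mulrCA; congr (_ * _).
  apply: design_seq_monomial; rewrite -ltnS.
  have := mpoly.msize_mdeg_lt mp; rewrite mpoly.mdegE => /leq_trans; exact.
- pose pts := [seq antipodal_point b u | b <- [:: false; true], u <- enum U].
  have -> : (2 * #|U| = size pts)%N by rewrite size_allpairs -cardE.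
  apply: uniq_leq_size; first exact: fset_uniq.
  move=> x xY; have : x \in design_seq by rewrite -memE -msuppE.
  case/mem_design => b [u [-> _]].
  by apply/allpairsP; exists (b, u); rewrite /= mem_enum; split=> //; case: b.
Qed.
End design_of_integer_points.

(** The points are the vectors (g (u . v_i))_i for u in F_P^r.  The least admissible r
    costs one factor P over the Gilbert-Varshamov bound.  For k = 0 the
    multiplicities are 1, and a single nonzero point is enough. *)
Lemma integer_points_family (R : realType) (k : nat) : exists C : nat, forall n,
  exists (U : finType) (X : U -> 'I_n.+1 -> int) (K : R),
    [/\ forall u, (0 < k)%N || (enorm (int_point R X u) != 0), K != 0,
     forall a : 'I_n.+1 -> nat, (\sum_i a i = k.*2)%N ->
      \sum_u monomial a (int_point R X u) = K * \prod_i (gauss_moment (a i))%:R &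
     (#|U| <= C * n.+1 ^ (k.*2 - 1))%N].
Proof.
have [->|k0] := posnP k.
  exists 1%N => n; exists unit, (fun _ i => (i == ord0)%:Z), 1; split.
  - move=> u; apply/orP; right; apply/eqP => /(@enorm_eq0 R _ (int_point R _ u) ord0)/eqP.
    by rewrite tnth_mktuple eqxx oner_eq0.
  - exact: oner_neq0.
  - move=> a /eqP; rewrite sum_nat_eq0 => /forallP a0.
    have {}a0 i : a i = 0%N by have /eqP := a0 i.
    rewrite [LHS](eq_bigr (fun=> 1)) => [|u _]; last by rewrite /monomial big1// => i _; rewrite a0.
    by rewrite sumr_const card_unit mul1r big1// => i _; rewrite a0.
  - by rewrite card_unit.
have [sq [N [pP N0 sqE]]] := gauss_multiset R k.*2.
set P := size sq in pP sqE.
pose F : finFieldType := 'F_P.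
have cF : #|F| = P by rewrite card_Fp.
pose g (b : F) : int := nth 0 sq (enum_rank b).
have gE j : (j <= k.*2)%N -> \sum_b (g b)%:~R ^+ j =
    P%:R * (N%:R ^+ j * (gauss_moment j)%:R) :> R.
  have cs : size sq = #|F| by rewrite cF.
  move=> jk; rewrite -sqE// [RHS](big_nth 0) cs [RHS]big_mkord.
  by rewrite (reindex enum_rank)//=; exists enum_val => b _; rewrite ?enum_rankK ?enum_valK.
pose t := k.*2.-1; have tE : t.+1 = k.*2 by rewrite prednK// double_gt0.
exists (P * P ^ t)%N => n.
pose r := (trunc_log P ((n.+1 * P) ^ t)).+1.
have P1 : (1 < P)%N by exact: prime_gt1.
have dP0 : (0 < (n.+1 * P) ^ t)%N by rewrite expn_gt0 muln_gt0 (ltnW P1).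
have /andP[rlo rhi] := trunc_log_bounds P1 dP0.
have [v vI] : exists v, wise_independent (F := F) (r := r) t n.+1 v.
  by apply: (@gilbert_varshamov F t r n.+1) => //; rewrite cF.
exists 'rV[F]_r, (fun u i => g (dotp u (v i))), (P%:R ^+ r * N%:R ^+ k.*2); split.
- by [].
- by rewrite mulf_neq0// expf_neq0// pnatr_eq0 -lt0n// ltnW.
- move=> a as_; pose A : {set 'I_n.+1} := [set i | a i != 0%N]%SET.
  have cA : (#|A| <= t.+1)%N.
    rewrite tE -as_ -sum1_card big_mkcond/= leq_sum// => i _.
    by rewrite /A finset.in_set; case: (a i).
  have in_A (h : 'I_n.+1 -> R) : (forall i, a i = 0%N -> h i = 1) ->
      \prod_i h i = \prod_(i in A) h i.
    move=> h1; rewrite [RHS]big_mkcond; apply: eq_bigr => i _.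
    by rewrite /A finset.in_set; case: eqP => // /h1.
  have := independent_moments vI (fun i b => (g b)%:~R ^+ a i : R) cA.
  rewrite (eq_bigr (fun i => P%:R * (N%:R ^+ a i * (gauss_moment (a i))%:R))); last first.
    by move=> i _; rewrite gE// -as_ (bigD1 i)//= leq_addr.
  have -> : \prod_(i in A) (P%:R * (N%:R ^+ a i * (gauss_moment (a i))%:R)) =
      P%:R ^+ #|A| * (N%:R ^+ k.*2 * \prod_i (gauss_moment (a i))%:R) :> R.
    rewrite !big_split/= prodr_const -as_ expr_sum; congr (_ * (_ * _)).
      by rewrite [RHS]in_A// => i ->; rewrite expr0.
    by rewrite [RHS]in_A// => i ->.
  rewrite cF !natrX => E; rewrite (eq_bigr (fun u => \prod_(i in A) (g (dotp u (v i)))%:~R ^+ a i)).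
    have PA : P%:R ^+ #|A| != 0 :> R by rewrite expf_neq0// pnatr_eq0 -lt0n// ltnW.
    by apply: (mulfI PA); rewrite E; ring.
  move=> u _; rewrite /monomial in_A => [|i ->]; last by rewrite expr0.
  by apply: eq_bigr => i _; rewrite tnth_mktuple.
- rewrite card_mx mul1n cF /r expnS.
  rewrite (leq_trans (leq_mul (leqnn P) rlo))// expnMn mulnA [in X in (_ <= X)%N]mulnAC.
  by rewrite subn1.
Qed.

Local Open Scope fset_scope.
Local Open Scope mset_scope.

Lemma weighted_of_unweighted (R : realType) (d t : nat) (Y : {mset d.-tuple R}) :
  unweighted_spherical_design t Y ->
  weighted_spherical_design t (finsupp Y) (fun x => (Y x)%:R / (size Y)%:R).
Proof.
move=> [onS exact_]; split=> [x|x|p /exact_ <-].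
- by rewrite msuppE; exact: onS.
- rewrite msuppE => xY; rewrite divr_gt0// ltr0n ?mset_gt0//.
  by rewrite -has_predT; apply/hasP; exists x.
- congr (_%:E); rewrite big_mset mulr_sumr; apply: eq_bigr => x _.
  by rewrite Monoid.iteropE iter_addr_0 mulrAC mulr_natl mulrnAl mulrnAr mulrC.
Qed.

Theorem corollary2 (R : realType) (t : nat) (ht : (0 < t)%N) :
  exists C : R, forall d : nat, (0 < d)%N ->
    (exists (X : {fset d.-tuple R}) (w : d.-tuple R -> R),
        weighted_spherical_design t X w /\
        (#|` X|)%:R <= C * d%:R ^+ (t - 1)) /\
    (exists X : {mset d.-tuple R},
        unweighted_spherical_design t X /\
        (#|` finsupp X|)%:R <= C * d%:R ^+ (t - 1)).
Proof.
(* A design of strength 2k + 1 covers both t = 2k and t = 2k + 1. *)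
pose k := t./2; have tk : (t <= k.*2.+1)%N.
  by rewrite -[X in (X <= _)%N]odd_double_half -add1n leq_add2r leq_b1.
have kt : (k.*2 <= t)%N by rewrite -[X in (_ <= X)%N]odd_double_half leq_addl.
have [C CP] := integer_points_family R k.
exists (2 * C)%:R => -[//|n] _.
have [U [X [K [nz K0 mom cU]]]] := CP n.
have [[onS exact_] cY] := design_of_integer_points nz K0 mom.
set Y := seq_mset _ in onS exact_ cY.
have Ydesign : unweighted_spherical_design t Y.
  by split=> // p pt; apply: exact_; rewrite (leq_trans pt).
have Ysize : (#|` finsupp Y|)%:R <= (2 * C)%:R * n.+1%:R ^+ (t - 1) :> R.
  rewrite -natrX -natrM ler_nat (leq_trans cY)// -mulnA leq_mul2l/=.
  by rewrite (leq_trans cU)// leq_mul2l leq_pexp2l ?orbT// leq_sub2r.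
split; last by exists Y.
exists (finsupp Y), (fun x => (Y x)%:R / (size Y)%:R); split=> //.
exact: weighted_of_unweighted.
Qed.
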